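(* Let $m\ge3$ be an integer, let $\omega$ be a complex number with $\omega^m=1$, and let $p$ be a real number with $1<p<2^{1/(4m)}$ such that $p^{2m}$ is different from the second Pisot number. Set $q:=p\omega$. Then every interior point (in $\mathbb C$) of the set $(p^m-1)J_q=\{(p^m-1)x: x\in J_q\}$ has a universal expansion in base $q$.
   Context: For a complex number $q$ with $|q|>1$, an expansion of a complex number $z$ in base $q$ is a sequence $(c_k)_{k\ge1}$ with $c_k\in\{0,1\}$ such that $\sum_{k=1}^\infty c_k q^{-k}=z$. $J_q$ denotes the set of complex numbers having at least one expansion in base $q$. An expansion is universal if the sequence contains every finite block of zeroes and ones as a block of consecutive terms. The second Pisot number is the second smallest Pisot number, $\approx1.3803$, the real root greater than $1$ of $x^4-x^3-1$. *)

(* Defs.v *)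
From HB Require Import structures.
From mathcomp Require Import all_boot all_order all_algebra.
From mathcomp Require Import complex.
From mathcomp Require Import all_classical all_reals all_analysis.

Set Implicit Arguments.
Unset Strict Implicit.
Unset Printing Implicit Defensive.

Import Order.TTheory GRing.Theory Num.Theory.
Import numFieldNormedType.Exports.

Local Open Scope classical_set_scope.
Local Open Scope ring_scope.
Local Open Scope complex_scope.

(* The topology on [R[i]] is the one induced by the complex modulus; it is
   carried by the alias [R[i]^o], which is convertible to [R[i]]. *)

(* Digit sequences are indexed from 0: [c k] is the digit of weight
   [q^-(k+1)], i.e. the (k+1)-st digit in the usual numbering. *)
Definition expansion (R : realType) (q : R[i]) (c : nat -> bool) (z : R[i]) :
    Prop :=
  series (fun k : nat => (c k)%:R * q ^- k.+1 : R[i]^o) @ \oo --> (z : R[i]^o).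

Definition expandable (R : realType) (q : R[i]) : set R[i]^o :=
  [set z | exists c, expansion q c z].

Definition universal (c : nat -> bool) : Prop :=
  forall b : seq bool, exists n : nat,
    forall i : nat, (i < size b)%N -> c (n + i)%N = nth false b i.

(* [P] is the minimal polynomial of the algebraic integer [x], so its complex
   roots are the conjugates of [x]. *)
Definition pisot (R : realType) : set R :=
  [set x | 1 < x /\
    exists P : {poly int},
      [/\ P \is monic,
          irreducible_poly (map_poly intr P : {poly rat}),
          root (map_poly intr P) x &
          forall z : R[i], root (map_poly intr P) z -> z != x%:C ->
            `|z| < 1]].

Definition least (R : realType) (A : set R) (x : R) : Prop :=
  A x /\ lbound A x.

Definition second_pisot (R : realType) (x : R) : Prop :=
  exists2 x1 : R, least (@pisot R) x1 & least (@pisot R `\ x1) x.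

(* Main.v *)
Require Import Defs.
From HB Require Import structures.
From mathcomp Require Import all_boot all_order all_algebra.
From mathcomp Require Import complex.
From mathcomp Require Import all_classical all_reals all_analysis.
From mathcomp Require Import zify ring lra.

(** Put Q = p^m, so that q^m = Q, 1 < Q and Q^4 < 2.  Grouping the digits by
    their position modulo m, the interior points of (Q - 1) J_q are the sums of
    t_j q^j over j < m with all t_j in ]0,1[.  A finite word of length m L
    acts on each coordinate t_j separately, by a word of length L in base Q, so it
    suffices to steer all coordinates simultaneously through prescribed blocks.
    This is possible as soon as the numbers y(Q), for y a polynomial with
    coefficients 0 and 1, have gaps tending to 0 at infinity.

    Exponents divisible by 4 already give gaps at most 1, because Q^4 < 2; hence
    it is enough to find arbitrarily small nonzero differences a(Q) - b(Q) with
    exponents of a and b not divisible by 4.  Otherwise these values are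
    eta-separated.  For a conjugate al of Q, the map y(Q) |-> y(al) is then, up
    to a bounded error, an additive function f on the half-line with
    f(Qx) = al f(x) + O(1); if al <> Q this forces f to be bounded, and so
    |al| < 1.  Thus Q would be a Pisot number smaller than 2^(1/4).  Smyth's
    argument excludes this: for the minimal polynomial P of Q and its reciprocal
    P^*, the power series P/P^* has integer coefficients, while multiplying it by
    (1 - Qz)/(z - Q) gives a Blaschke product, whose squared coefficients sum to
    at most 1. *)

Set Implicit Arguments.
Unset Strict Implicit.
Unset Printing Implicit Defensive.

Import Order.TTheory GRing.Theory Num.Theory.
Import numFieldNormedType.Exports ComplexField.Normc.

Local Open Scope classical_set_scope.
Local Open Scope ring_scope.
Local Open Scope complex_scope.


(** * Polynomials with coefficients 0 and 1 *)

(** The ring is arbitrary so that one digit polynomial can be read both at [Q] and at a complex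
    conjugate of [Q]. *)
Definition eval_at (F : nzRingType) (x : F) (y : {poly int}) : F :=
  (map_poly intr y).[x].

Lemma eval_atD (F : nzRingType) (x : F) y y' :
  eval_at x (y + y') = eval_at x y + eval_at x y'.
Proof. by rewrite /eval_at rmorphD hornerD. Qed.

Lemma eval_atB (F : nzRingType) (x : F) y y' :
  eval_at x (y - y') = eval_at x y - eval_at x y'.
Proof. by rewrite /eval_at rmorphB /= hornerD hornerN. Qed.

Lemma eval_atM (F : comNzRingType) (x : F) y y' :
  eval_at x (y * y') = eval_at x y * eval_at x y'.
Proof. by rewrite /eval_at rmorphM hornerM. Qed.

Lemma eval_at0 (F : nzRingType) (x : F) : eval_at x 0 = 0.
Proof. by rewrite /eval_at rmorph0 horner0. Qed.

Lemma eval_atXn (F : comNzRingType) (x : F) n : eval_at x 'X^n = x ^+ n.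
Proof. by rewrite /eval_at map_polyXn hornerXn. Qed.

Lemma eval_at_rmorph (F G : comNzRingType) (f : {rmorphism F -> G}) x y :
  eval_at (f x) y = f (eval_at x y).
Proof.
rewrite /eval_at -horner_map -map_poly_comp; congr (_.[_]).
by apply: eq_map_poly => i /=; rewrite rmorph_int.
Qed.

Lemma eval_atE (F : nzRingType) (x : F) (y : {poly int}) n : (size y <= n)%N ->
  eval_at x y = \sum_(i < n) (y`_i)%:~R * x ^+ i.
Proof.
move=> sy; rewrite /eval_at (horner_coef_wide x (leq_trans (size_poly _ _) sy)).
by apply: eq_bigr => i _; rewrite coef_map.
Qed.

(** Confining the exponents to [S] lets digit polynomials over disjoint classes be added without
    creating a coefficient 2. *)
Definition digits (S : pred nat) (y : {poly int}) : Prop :=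
  forall i, y`_i = 0 \/ S i /\ y`_i = 1.

Lemma digits0 S : digits S 0.
Proof. by move=> i; left; rewrite coef0. Qed.

Lemma digits_sub (S S' : pred nat) y :
  (forall i, S i -> S' i) -> digits S y -> digits S' y.
Proof. by move=> SS' Sy i; case: (Sy i) => [->|[/SS' ? ->]]; [left|right]. Qed.

Lemma digitsD (S S' U : pred nat) y y' :
  (forall i, S i -> U i) -> (forall i, S' i -> U i) ->
  (forall i, S i -> S' i -> False) ->
  digits S y -> digits S' y' -> digits U (y + y').
Proof.
move=> SU S'U SS' Sy S'y' i; rewrite coefD.
case: (Sy i) => [->|[Si ->]]; case: (S'y' i) => [->|[S'i ->]].
- by left.
- by right; split; [exact: S'U|].
- by right; split; [exact: SU|].
- by case: (SS' i).
Qed.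

Lemma digitsXn (S S' : pred nat) k y :
  (forall i, S i -> S' (k + i)%N) -> digits S y -> digits S' ('X^k * y).
Proof.
move=> SS' Sy i; rewrite coefXnM; case: ltnP => ki; first by left.
case: (Sy (i - k)%N) => [->|[/SS' + ->]]; first by left.
by rewrite subnKC // => ?; right.
Qed.

Lemma digits_Xn (S : pred nat) k : S k -> digits S 'X^k.
Proof. by move=> Sk i; rewrite coefXn; case: eqP => [->|_]; [right|left]. Qed.

Lemma digits_cut (S : pred nat) (y : {poly int}) n : (size y <= n)%N ->
  digits S y -> digits (fun i => S i && (i < n)%N) y.
Proof.
move=> yn Sy i; case: (ltnP i n) => ni.
  by case: (Sy i) => [->|[Si ->]]; [left|right; rewrite Si].
by left; rewrite nth_default // (leq_trans yn).
Qed.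

Section Base.
Variables (R : realType) (Q : R).
Hypotheses (Q1 : 1 < Q) (Q42 : Q ^+ 4 < 2).

Let Q0 : 0 < Q. Proof. exact: lt_trans Q1. Qed.

Lemma digits_ge0 S y : digits S y -> 0 <= eval_at Q y.
Proof.
move=> Sy; rewrite (eval_atE Q (leqnn _)); apply: sumr_ge0 => i _.
by case: (Sy i) => [->|[_ ->]]; rewrite ?mul0r // mul1r exprn_ge0 // ltW.
Qed.

Lemma digits_ge_pow S y i : digits S y -> y`_i != 0 -> Q ^+ i <= eval_at Q y.
Proof.
move=> Sy yi0.
have yi : y`_i = 1 by case: (Sy i) yi0 => [->|[_ ->]]; rewrite ?eqxx.
have iy : (i < size y)%N by rewrite ltnNge; apply: contra yi0 => /leq_sizeP ->.
rewrite (eval_atE Q (leqnn _)) (bigD1 (Ordinal iy)) //= yi mul1r lerDl.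
apply: sumr_ge0 => j _.
by case: (Sy j) => [->|[_ ->]]; rewrite ?mul0r // mul1r exprn_ge0 // ltW.
Qed.

Lemma digits_size S y n : digits S y -> eval_at Q y < Q ^+ n -> (size y <= n)%N.
Proof.
move=> Sy yn; apply/leq_sizeP => i ni; apply/eqP; apply: contraLR yn => yi0.
by rewrite -leNgt (le_trans _ (digits_ge_pow Sy yi0)) // ler_weXn2l // ltW.
Qed.

Lemma exists_exprn_gt (x : R) : exists n, x < Q ^+ n.
Proof.
(* Bernoulli's inequality. *)
have B n : 1 + n%:R * (Q - 1) <= Q ^+ n.
  elim: n => [|n IH]; first by rewrite mul0r addr0.
  rewrite exprS; apply: le_trans (ler_wpM2l (ltW Q0) IH).
  have : 0 <= n%:R * (Q - 1) ^+ 2 by rewrite mulr_ge0 // sqr_ge0.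
  rewrite -natr1; move: (n%:R) => k; nra.
have := archi_boundP (normr_ge0 (x / (Q - 1))); set n := Num.bound _ => xn.
exists n; apply: lt_le_trans (B n); have Qm : 0 < Q - 1 by rewrite subr_gt0.
have := le_lt_trans (ler_norm _) xn; rewrite ltr_pdivrMr //; lra.
Qed.

Definition residue (j : nat) : pred nat := fun i => (i %% 4 == j)%N.

(** Greedy expansion in base [Q ^+ 4]. As this base is below 2, each of its powers is at most 1 plus
    the sum of the smaller ones ([B]), so no hole is left below the top power. *)
Lemma greedy4 n (x : R) : 0 <= x -> x < \sum_(i < n) Q ^+ (4 * i) + 1 ->
  exists2 y, digits (fun i => residue 0 i && (i < 4 * n)%N) y &
    eval_at Q y <= x < eval_at Q y + 1.
Proof.
have B k : Q ^+ (4 * k) <= \sum_(i < k) Q ^+ (4 * i) + 1.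
  elim: k => [|k IH]; first by rewrite big_ord0 add0r.
  rewrite big_ord_recr /= mulnS exprD.
  have : 0 <= Q ^+ (4 * k) by rewrite exprn_ge0 // ltW.
  move: Q42 IH; set a := Q ^+ 4; set b := Q ^+ (4 * k); nra.
elim: n x => [|n IH] x x0.
  rewrite big_ord0 add0r => x1; exists 0; first exact: digits0.
  by rewrite eval_at0 x0 add0r.
rewrite big_ord_recr /= => xn; case: (ltP x (Q ^+ (4 * n))) => xQ.
  have [y yd yx] := IH x x0 (lt_le_trans xQ (B n)).
  exists y => //; apply: digits_sub yd => i /andP[-> /leq_trans] /=; apply; lia.
have [||y yd yx] := IH (x - Q ^+ (4 * n)); [by rewrite subr_ge0|lra|].
exists ('X^(4 * n) + y); last by rewrite eval_atD eval_atXn; lra.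
apply: (@digitsD (fun i => i == 4 * n)%N _ _ _ _ _ _ _ _ yd) => /=.
- by move=> i /eqP ->; rewrite /residue; lia.
- by move=> i /andP[-> /leq_trans] /=; apply; lia.
- by move=> i /eqP -> /andP[_]; lia.
- exact: digits_Xn.
Qed.

Lemma gap0 (x : R) : 0 <= x ->
  exists2 y, digits (residue 0) y & eval_at Q y <= x < eval_at Q y + 1.
Proof.
move=> x0; have [n xn] := exists_exprn_gt x.
have [|y yd yx] := @greedy4 n.+1 x x0.
  rewrite big_ord_recr /=; have : 0 <= \sum_(i < n) Q ^+ (4 * i).
    by apply: sumr_ge0 => i _; rewrite exprn_ge0 // ltW.
  have : Q ^+ n <= Q ^+ (4 * n) by rewrite ler_weXn2l ?(ltW Q1) //; lia.
  lra.
by exists y => //; apply: digits_sub yd => i /andP[].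
Qed.

(** Multiplication by [Q ^+ j] carries class 0 to class [j] and stretches the gaps from 1 to
    [Q ^+ j <= Q ^+ 4 < 2]. *)
Lemma gap j (x : R) : (j < 4)%N -> 0 <= x ->
  exists2 y, digits (residue j) y & eval_at Q y <= x < eval_at Q y + 2.
Proof.
move=> j4 x0; have Qj : 0 < Q ^+ j by rewrite exprn_gt0.
have [|y yd yx] := @gap0 (x / Q ^+ j); first by rewrite divr_ge0 // ltW.
exists ('X^j * y).
  by apply: digitsXn yd => i; rewrite /residue; lia.
rewrite eval_atM eval_atXn; move: yx; rewrite ler_pdivlMr // ltr_pdivrMr //.
have : Q ^+ j <= Q ^+ 4 by rewrite ler_weXn2l ?(ltW Q1) // ltnW.
move: Q42 Qj; set a := Q ^+ j; set b := Q ^+ 4; move=> *; nra.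
Qed.

End Base.

(** * Quasi-additive functions *)

Section Normc.
Variable R : rcfType.
Implicit Types z w : R[i].

Lemma normr_normc z : `|z| = (normc z)%:C.
Proof. by []. Qed.

Lemma normc_ge0 z : 0 <= normc z.
Proof. by case: z => x y; rewrite /= sqrtr_ge0. Qed.

Lemma normcX z n : normc (z ^+ n) = normc z ^+ n.
Proof.
elim: n => [|n IH]; first exact: normc1.
by rewrite !exprS normcM IH.
Qed.

Lemma normc_real (x : R) : normc x%:C = `|x|.
Proof. by rewrite /= expr0n addr0 sqrtr_sqr. Qed.

Lemma normcD z w : normc (z + w) <= normc z + normc w.
Proof. exact: le_normcD. Qed.

Lemma normcB z w : normc (z - w) <= normc z + normc w.
Proof. by rewrite -(normcN w) normcD. Qed.

Lemma normc_dist z w : normc z <= normc (z - w) + normc w.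
Proof. by have := normcD (z - w) w; rewrite subrK. Qed.

Lemma normc_distC z w : normc (z - w) = normc (w - z).
Proof. by rewrite -normcN opprB. Qed.

Lemma normc_parallelogram z w :
  normc (z + w) ^+ 2 + normc (z - w) ^+ 2 = 2 * (normc z ^+ 2 + normc w ^+ 2).
Proof.
case: z w => [a b] [c d] /=; rewrite !sqr_sqrtr; first ring.
all: by rewrite addr_ge0 // sqr_ge0.
Qed.

End Normc.

(* An additive defect of size [c] and a scaling relation with ratio [al <> Q]
   leave no room for linear growth. *)
Lemma quasi_additive_bounded (R : realType) (Q : R) (al : R[i])
    (f : R -> R[i]) (c : R) : 0 < Q -> al != Q%:C -> 
  (forall x y, 0 <= x -> 0 <= y -> normc (f (x + y) - f x - f y) <= c) ->
  (forall x, 0 <= x -> normc (f (Q * x) - al * f x) <= c) ->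
  (forall x, 0 <= x -> exists b, forall y, 0 <= y <= x -> normc (f y) <= b) ->
  exists b, forall x, 0 <= x -> normc (f x) <= b.
Proof.
move=> Q0 alQ fD fM fb.
have c0 : 0 <= c by apply: le_trans (fM 0 (lexx 0)); exact: normc_ge0.
set d := normc (al - Q%:C).
have d0 : 0 < d.
  rewrite lt_neqAle normc_ge0 andbT eq_sym; apply: contra alQ => /eqP.
  by move=> /eq0_normc /eqP; rewrite subr_eq0.
have fn x n : 0 <= x -> normc (f (n%:R * x) - n%:R * f x) <= c * n.+1%:R.
  move=> x0; elim: n => [|n IH].
    have := fD 0 0 (lexx 0) (lexx 0).
    by rewrite addr0 subrr sub0r normcN !mul0r subr0 mulr1.
  have := fD (n%:R * x) x (mulr_ge0 (ler0n _ _) x0) x0.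
  have -> : n%:R * x + x = n.+1%:R * x by rewrite -natr1 mulrDl mul1r.
  set A := f (n.+1%:R * x) => H.
  have -> : A - n.+1%:R * f x =
      (A - f (n%:R * x) - f x) + (f (n%:R * x) - n%:R * f x).
    by rewrite -(natr1 n) mulrDl mul1r; ring.
  by rewrite (le_trans (normcD _ _)) // -(natr1 n.+1) mulrDr mulr1 addrC lerD.
exists (c * (normc al + Q) / d) => x x0; rewrite ler_pdivlMr //.
have [b fbx] := fb x x0.
set N := normc (f x); have N0 : 0 <= N by exact: normc_ge0.
set C := N + c + c * normc al + c + c + b.
(* [f (Q * (n%:R * x))] is estimated twice: by scaling it is about [al * n%:R * f x], by additivity
   about [k%:R * f x] with [k] the integer part of [Q * n%:R]. Both errors grow linearly in [n] with
   slopes independent of [x]; the constant [C] does depend on [x], but is negligible for large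
   [n]. *)
have key n : N * d * n%:R <= c * (normc al + Q) * n%:R + C.
  pose k := Num.truncn (Q * n%:R).
  have Qn : 0 <= Q * n%:R by rewrite mulr_ge0 // ltW.
  have /andP[kl ku] : k%:R <= Q * n%:R < k.+1%:R by exact: truncn_itv.
  set r := (Q * n%:R - k%:R) * x.
  have r0 : 0 <= r by rewrite mulr_ge0 // subr_ge0.
  have rx : r <= x.
    by rewrite ler_piMl // lerBlDl natr1 ltW.
  have e1 := fM (n%:R * x) (mulr_ge0 (ler0n _ _) x0).
  have e2 := fD (k%:R * x) r (mulr_ge0 (ler0n _ _) x0) r0.
  have e3 := fn x n x0.
  have e4 := fn x k x0.
  have e5 : normc (f r) <= b by apply: fbx; rewrite r0.
  have E : k%:R * x + r = Q * (n%:R * x) by rewrite /r; ring.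
  rewrite E in e2.
  set F := f (Q * (n%:R * x)) in e1 e2.
  set G := f (n%:R * x) in e1 e3.
  set H := f (k%:R * x) in e2 e4.
  have -> : N * d * n%:R = normc ((al - Q%:C) * n%:R * f x).
    have -> : n%:R = n%:R%:C :> R[i] by rewrite rmorph_nat.
    by rewrite !normcM normc_real normr_nat -/d -/N; ring.
  have -> : (al - Q%:C) * n%:R * f x =
    - (F - al * G) + (F - H - f r) - al * (G - n%:R * f x) + (H - k%:R * f x)
     + f r - (Q * n%:R - k%:R)%:C * f x.
    by rewrite rmorphB rmorphM !rmorph_nat; ring.
  have e6 : normc (al * (G - n%:R * f x)) <= normc al * (c * n.+1%:R).
    by rewrite normcM ler_wpM2l // normc_ge0.
  have e7 : normc ((Q * n%:R - k%:R)%:C * f x) <= N.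
    rewrite normcM normc_real ler_piMl // ger0_norm.
      by rewrite lerBlDl natr1 ltW.
    by rewrite subr_ge0.
  set t1 := F - al * G in e1 *; set t2 := F - H - f r in e2 *.
  set t3 := al * _ in e6 *; set t4 := H - _ in e4 *; set t5 := _%:C * _ in e7 *.
  have := normcD (- t1) t2; have := normcB (- t1 + t2) t3.
  have := normcD (- t1 + t2 - t3) t4; have := normcD (- t1 + t2 - t3 + t4) (f r).
  have := normcB (- t1 + t2 - t3 + t4 + f r) t5; rewrite normcN.
  have e8 : c * k.+1%:R <= c * (Q * n%:R + 1).
    by rewrite ler_wpM2l // -natr1 lerD2r.
  move: e6; rewrite -(natr1 n) /C => e6. 
  lra.
rewrite leNgt; apply/negP => lt.
set e := N * d - c * (normc al + Q); have e0 : 0 < e by rewrite subr_gt0.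
have := archi_boundP (normr_ge0 (C / e)); set n := Num.bound _ => Cn.
have := le_lt_trans (ler_norm _) Cn; rewrite ltr_pdivrMr // => {}Cn.
have := key n; move: Cn; rewrite /e mulrBr; lra.
Qed.

(** * Conjugates of a base with separated digit sums *)

(** Class 0 is reserved for the coarse filling of gaps in [digits_dense]. Classes 1 and 2 carry the
    numbers compared at [al], class 3 the corrections that move them into a common window. *)
Definition residue12 : pred nat := fun i => residue 1 i || residue 2 i.
Definition residue123 : pred nat := fun i => ~~ residue 0 i.

Lemma digits_residueXn j j' k y : ((k + j) %% 4 = j')%N ->
  digits (residue j) y -> digits (residue j') ('X^k * y).
Proof. by move=> <-; apply: digitsXn => i; rewrite /residue; lia. Qed.

Lemma digits12_3 a w : digits residue12 a -> digits (residue 3) w ->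
  digits residue123 (a + w).
Proof. by apply: digitsD => i; rewrite /residue12 /residue123 /residue; lia. Qed.

Lemma digits1_2 a b : digits (residue 1) a -> digits (residue 2) b ->
  digits residue12 (a + b).
Proof. by apply: digitsD => i; rewrite /residue12 /residue; lia. Qed.

Lemma digits1_cons a : digits (residue 1) a ->
  digits (residue 1) ('X^1 + 'X^4 * a).
Proof.
move=> /(digitsXn (S' := fun i => residue 1 i && (4 <= i)%N) (k := 4%N)) h.
by apply: digitsD (digits_Xn (S := fun i => i == 1%N) (eqxx _)) (h _);
  move=> i /=; rewrite /residue; lia.
Qed.

Section Conjugates.
Variables (R : realType) (Q : R).
Hypotheses (Q1 : 1 < Q) (Q42 : Q ^+ 4 < 2).

Definition digits_separated (eta : R) : Prop :=
  forall a b, digits residue123 a -> digits residue123 b ->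
    eval_at Q a != eval_at Q b -> eta <= `|eval_at Q a - eval_at Q b|.

(** This is what being a conjugate of [Q] contributes: [y(Q) |-> y(al)] is well defined on digit
    values. It makes sense before [Q] is known to be algebraic. *)
Definition specializes (al : R[i]) : Prop :=
  forall a b, digits residue123 a -> digits residue123 b ->
    eval_at Q a = eval_at Q b -> eval_at al a = eval_at al b.

Variables (eta : R) (al : R[i]).
Hypotheses (eta0 : 0 < eta) (sep : digits_separated eta) (spec : specializes al).

Let Q0 : 0 < Q. Proof. exact: lt_trans Q1. Qed.

(* If [w] (digits in class 3) is close to [Z - b(Q)], then [a + w] and [b + w]
   both lie in a bounded window around [Z], where a separated set has few
   points. *)
Lemma separated_bounded (K : R) : exists M : R, forall a b,
  digits residue12 a -> digits residue12 b ->
  `|eval_at Q a - eval_at Q b| <= K ->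
  normc (eval_at al a - eval_at al b) <= M.
Proof.
apply: contrapT => /forallNP unb.
have /choice[g gP] (M : R) : exists ab : {poly int} * {poly int},
   [/\ digits residue12 ab.1, digits residue12 ab.2,
     `|eval_at Q ab.1 - eval_at Q ab.2| <= K &
     M < normc (eval_at al ab.1 - eval_at al ab.2)].
  have := unb M; move=> /existsNP[a] /existsNP[b] /not_implyP[da].
  move=> /not_implyP[db] /not_implyP[ab] /negP; rewrite -ltNge => lt.
  by exists (a, b).
pose v (ab : {poly int} * {poly int}) : R[i] := eval_at al ab.1 - eval_at al ab.2.
(* From arbitrarily large differences at [al], extract a sequence of pairs whose differences have
   strictly increasing modulus, hence are distinct. *)
pose s := fix s n := if n is k.+1 then g (normc (v (s k))) else g 0.
have sP n : [/\ digits residue12 (s n).1, digits residue12 (s n).2 &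
     `|eval_at Q (s n).1 - eval_at Q (s n).2| <= K].
  by case: n => [|n] /=; [case: (gP 0)|case: (gP (normc (v (s n))))].
have vS n : normc (v (s n)) < normc (v (s n.+1)).
  by rewrite /=; case: (gP (normc (v (s n)))).
have vI i j : (i < j)%N -> normc (v (s i)) < normc (v (s j)).
  elim: j => // j IH; rewrite ltnS leq_eqVlt => /orP[/eqP -> //|/IH /lt_trans].
  exact.
(* The window has length [2 * K + 2] and is cut into at most [B.+1] cells of length [eta]; [N]
   exceeds the number of pairs of cells by one, for the pigeonhole principle. Taking [Z] as the sum
   of all second entries makes each [Z - eval_at Q (s j).2] nonnegative. *)
pose B := Num.truncn ((2 * K + 2) / eta); pose N := (B.+1 * B.+1).+1.
pose Z := \sum_(j < N) eval_at Q (s j).2.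
have K0 : 0 <= K by case: (sP 0%N) => _ _; apply: le_trans.
have /choice[w wP] (j : 'I_N) : exists w, digits (residue 3) w /\
    eval_at Q w <= Z - eval_at Q (s j).2 < eval_at Q w + 2.
  have [|w wd wz] := @gap R Q Q1 Q42 3%N (Z - eval_at Q (s j).2) isT.
    rewrite subr_ge0 /Z (bigD1 j) //= lerDl; apply: sumr_ge0 => i _.
    by case: (sP i) => _ /(digits_ge0 Q1).
  by exists w.
pose bk (x : R) : 'I_B.+1 := inord (Num.truncn ((x - (Z - 2 - K)) / eta)).
have bkP x y : Z - 2 - K <= x <= Z + K -> Z - 2 - K <= y <= Z + K ->
    bk x = bk y -> `|x - y| < eta.
  have e x0 : Z - 2 - K <= x0 <= Z + K -> exists2 u : nat, bk x0 = u :> nat &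
      u%:R * eta <= x0 - (Z - 2 - K) < u.+1%:R * eta.
    move=> xb; set u := Num.truncn ((x0 - (Z - 2 - K)) / eta).
    have h : 0 <= (x0 - (Z - 2 - K)) / eta by apply: divr_ge0; [lra|exact: ltW].
    have := truncn_itv h; rewrite -/u ler_pdivlMr // ltr_pdivrMr // => uv.
    exists u => //; rewrite /bk inordK // ltnS.
    apply: le_truncn; rewrite ler_pM2r ?invr_gt0 //; lra.
  move=> /e[u eu ux] /e[u' eu' uy] /(congr1 val); rewrite /= eu eu' => uu'.
  move: ux uy; rewrite uu' -(natr1 u') mulrDl mul1r ltr_norml; lra.
pose phi (j : 'I_N) :=
  (bk (eval_at Q ((s j).1 + w j)), bk (eval_at Q ((s j).2 + w j))).
have : ~ injective phi.
  by move=> /leq_card; rewrite card_prod !card_ord /N ltnn.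
apply=> i j [e1 e2]; apply: val_inj => /=.
have win (k : 'I_N) : (Z - 2 - K <= eval_at Q ((s k).1 + w k) <= Z + K) /\
     (Z - 2 - K <= eval_at Q ((s k).2 + w k) <= Z + K).
  case: (sP k) => _ _; case: (wP k) => _; rewrite !eval_atD ler_norml; lra.
have eqv a b : digits residue123 a -> digits residue123 b ->
    `|eval_at Q a - eval_at Q b| < eta -> eval_at al a = eval_at al b.
  move=> da db; apply: contraTeq => ne; rewrite -leNgt.
  by apply: sep => //; apply: contra_neq ne; apply: spec.
(* Values at [Q] in one cell coincide by separation, hence so do the values at [al]; the corrections
   [w] cancel in the differences. *)
have : v (s i) = v (s j).
  have [d1 d2 _] := sP i; have [d3 d4 _] := sP j.
  have [dw _] := wP i; have [dw' _] := wP j.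
  have h1 := eqv _ _ (digits12_3 d1 dw) (digits12_3 d3 dw')
     (bkP _ _ (win i).1 (win j).1 e1).
  have h2 := eqv _ _ (digits12_3 d2 dw) (digits12_3 d4 dw')
     (bkP _ _ (win i).2 (win j).2 e2).
  rewrite /v; move: h1 h2; rewrite !eval_atD => h1 h2.
  have -> : eval_at al (s i).1 - eval_at al (s i).2 =
    (eval_at al (s i).1 + eval_at al (w i)) - 
    (eval_at al (s i).2 + eval_at al (w i)) by ring.
  by rewrite h1 h2; ring.
case: (ltngtP i j) => // /vI lt e; by rewrite e ltxx in lt.
Qed.

(** Let [f x] be the value at [al] of a class 1 polynomial whose value at [Q] approximates [x]. It
    is additive and [al]-homogeneous up to bounded errors, hence bounded, and so are all class 1
    values at [al]. If [1 <= normc al], suitable differences of such values are unbounded. *)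
Lemma conjugate_norm_lt1 : al != Q%:C -> normc al < 1.
Proof.
move=> alQ; rewrite ltNge; apply/negP => al1.
have Q2 : Q < 2.
  apply: le_lt_trans Q42; rewrite -[leLHS]expr1 ler_weXn2l //; exact: ltW.
(* The pairs compared below differ at [Q] by less than 4, so 6 is ample. *)
have [M MP] := separated_bounded 6.
have M0 : 0 <= M.
  apply: le_trans (MP 0 0 (digits0 _) (digits0 _) _); first exact: normc_ge0.
  by rewrite subrr normr0.
have /choice[y yP] (x : R) : exists y, 0 <= x -> digits (residue 1) y /\
    eval_at Q y <= x < eval_at Q y + 2.
  case: (leP 0 x) => [x0|]; last by exists 0.
  by have [y] := @gap R Q Q1 Q42 1%N x isT x0; exists y.
have r1 a : digits (residue 1) a -> digits residue12 a.
  by apply: digits_sub => i; rewrite /residue12 => ->.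
have r2 a : digits (residue 2) a -> digits residue12 a.
  by apply: digits_sub => i; rewrite /residue12 orbC => ->.
pose f x := eval_at al (y x).
have fD x x' : 0 <= x -> 0 <= x' -> normc (f (x + x') - f x - f x') <= 2 * M.
  (* [y x + y x'] may have coefficients 2, so [x'] is first approximated by a class 2 polynomial
     [t]. *)
  move=> x0 x0'; have [t td tx] := @gap R Q Q1 Q42 2%N x' isT x0'.
  have [d1 b1] := yP x x0; have [d2 b2] := yP x' x0'.
  have [d3 b3] := yP (x + x') (addr_ge0 x0 x0').
  have h1 := MP _ _ (r1 _ d3) (digits1_2 d1 td).
  have h2 := MP _ _ (r2 _ td) (r1 _ d2).
  have -> : f (x + x') - f x - f x' = (f (x + x') - eval_at al (y x + t)) +
     (eval_at al t - f x') by rewrite eval_atD /f; ring.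
  rewrite (le_trans (normcD _ _)) // mulr_natl mulr2n lerD //.
    by apply: h1; rewrite eval_atD ler_norml; lra.
  by apply: h2; rewrite ler_norml; lra.
have fM x : 0 <= x -> normc (f (Q * x) - al * f x) <= 2 * M.
  move=> x0; have [d1 b1] := yP x x0.
  have [d2 b2] := yP (Q * x) (mulr_ge0 (ltW Q0) x0).
  have d3 : digits (residue 2) ('X^1 * y x).
    exact: digits_residueXn d1.
  have := MP _ _ (r1 _ d2) (r2 _ d3); rewrite !eval_atM !eval_atXn !expr1.
  rewrite -/(f x) -/(f (Q * x)) => h.
  apply: le_trans (h _) _; last lra.
  case/andP: b1 => /(ler_wpM2l (ltW Q0)) l1 l2.
  have {}l2 : Q * x < Q * (eval_at Q (y x) + 2) by rewrite ltr_pM2l.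
  rewrite mulrDr in l2; rewrite ler_norml; lra.
have fb x : 0 <= x -> exists b, forall x', 0 <= x' <= x -> normc (f x') <= b.
  move=> x0; have [n xn] := exists_exprn_gt Q1 x.
  exists (\sum_(i < n) normc al ^+ i) => x' /andP[x0' x'x].
  have [d b] := yP x' x0'.
  have sz : (size (y x') <= n)%N by apply: (digits_size Q1 d); lra.
  rewrite /f (eval_atE _ sz).
  elim/big_ind2: _ => [|u u' t t' uu' tt'|i _]; first by rewrite normc0.
    by rewrite (le_trans (normcD _ _)) // lerD.
  case: (d i) => [->|[_ ->]]; last by rewrite mul1r normcX.
  by rewrite mul0r normc0 exprn_ge0 // normc_ge0.
have [b bP] := quasi_additive_bounded Q0 alQ fD fM fb.
have ub a : digits (residue 1) a -> normc (eval_at al a) <= M + b.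
  move=> da; have a0 := digits_ge0 Q1 da; have [d1 b1] := yP _ a0.
  apply: le_trans (normc_dist _ (f (eval_at Q a))) _; apply: lerD; last exact: bP.
  by apply: MP; [exact: r1|exact: r1|rewrite ler_norml; lra].
(* By the parallelogram law one of [al ^+ 4 * z + al] and [al ^+ 4 * z - al] has squared modulus at
   least [normc z ^+ 2 + 1]. The sign is realised by giving the new term ['X^1] to [a] or to [c]. *)
have big n : exists a b, [/\ digits (residue 1) a, digits (residue 1) b &
    n%:R <= normc (eval_at al a - eval_at al b) ^+ 2].
  elim: n => [|n [a [c [da dc ac]]]].
    by exists 0, 0; split; [exact: digits0|exact: digits0|rewrite sqr_ge0].
  have ds u : digits (residue 1) u -> digits (residue 1) ('X^4 * u).
    exact: digits_residueXn.
  set z := eval_at al a - eval_at al c.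
  have := normc_parallelogram (al ^+ 4 * z) al.
  rewrite normcM normcX exprMn => pg.
  have z0 := sqr_ge0 (normc z); rewrite -/z in ac.
  have a8 : 1 <= (normc al ^+ 4) ^+ 2 by rewrite !exprn_ege1.
  have a2 : 1 <= normc al ^+ 2 by rewrite exprn_ege1.
  have le8 : normc z ^+ 2 <= (normc al ^+ 4) ^+ 2 * normc z ^+ 2 by rewrite ler_peMl.
  case: (leP n.+1%:R (normc (al ^+ 4 * z + al) ^+ 2)) => [le|gt].
    exists ('X^1 + 'X^4 * a), ('X^4 * c); split; [exact: digits1_cons|exact: ds|].
    move: le; congr (_ <= normc _ ^+ 2).
    by rewrite eval_atD !eval_atM !eval_atXn /z; ring.
  exists ('X^4 * a), ('X^1 + 'X^4 * c); split; [exact: ds|exact: digits1_cons|].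
  have -> : eval_at al ('X^4 * a) - eval_at al ('X^1 + 'X^4 * c) = al ^+ 4 * z - al.
    by rewrite eval_atD !eval_atM !eval_atXn /z; ring.
  move: gt pg ac; rewrite -(natr1 n); lra.
have [n nP] : exists n : nat, (M + b + (M + b)) ^+ 2 < n%:R.
  by exists (Num.bound ((M + b + (M + b)) ^+ 2)); apply: archi_boundP; exact: sqr_ge0.
have [a [c [da dc]]] := big n; apply/negP; rewrite -ltNge; apply: le_lt_trans nP.
have le : normc (eval_at al a - eval_at al c) <= M + b + (M + b).
  by rewrite (le_trans (normcB _ _)) // lerD // ub.
by rewrite lerXn2r // nnegrE ?normc_ge0 // (le_trans _ le) // normc_ge0.
Qed.

End Conjugates.

(** * Truncated Blaschke products *)

(** Congruence modulo ['X^N]: polynomials stand for truncated power series. *)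
Definition eqmodX (F : nzRingType) N (p q : {poly F}) : Prop :=
  forall i, (i < N)%N -> p`_i = q`_i.

Lemma eqmodX_sym (F : nzRingType) N (p q : {poly F}) :
  eqmodX N p q -> eqmodX N q p.
Proof. by move=> pq i /pq. Qed.

Lemma eqmodX_trans (F : nzRingType) N (q p r : {poly F}) :
  eqmodX N p q -> eqmodX N q r -> eqmodX N p r.
Proof. by move=> pq qr i iN; rewrite pq // qr. Qed.

Lemma eqmodXM (F : nzRingType) N (p p' q q' : {poly F}) :
  eqmodX N p p' -> eqmodX N q q' -> eqmodX N (p * q) (p' * q').
Proof.
move=> pp' qq' i iN; rewrite !coefM; apply: eq_bigr => j _.
rewrite pp' ?qq' //; first by rewrite (leq_ltn_trans (leq_subr _ _)).
by apply: leq_ltn_trans iN; rewrite -ltnS.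
Qed.

Lemma eqmodX_map (F G : nzRingType) (f : {rmorphism F -> G}) N (p q : {poly F}) :
  eqmodX N p q -> eqmodX N (map_poly f p) (map_poly f q).
Proof. by move=> pq i iN; rewrite !coef_map pq. Qed.

(** Geometric series in [1 - p], whose constant term vanishes. *)
Lemma eqmodX_inv (F : comNzRingType) N (p : {poly F}) : p`_0 = 1 ->
  exists u, eqmodX N (p * u) 1.
Proof.
move=> p0; set e := 1 - p; exists (\sum_(j < N) e ^+ j) => i iN.
have -> : p = 1 - e by rewrite /e opprB addrCA subrr addr0.
have -> : (1 - e) * (\sum_(j < N) e ^+ j) = 1 - e ^+ N.
  by rewrite -[1 in RHS](expr1n _ N) subrXX; congr (_ * _);
     apply: eq_bigr => j _; rewrite expr1n mul1r.
have -> : e = drop_poly 1 e * 'X.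
  rewrite -{1}(poly_take_drop 1 e) expr1 [X in X + _](_ : _ = 0) ?add0r //.
  apply/polyP => -[|k]; rewrite coef_take_poly coef0 //=.
  by rewrite coefB coef1 p0 subrr.
by rewrite coefB exprMn coefMXn iN subr0.
Qed.

(** The product of the [1 - a%:P * 'X] is the reciprocal polynomial of the product of the
    ['X - a%:P]. *)
Lemma prod_XsubC_rev (F : comNzRingType) (rs : seq F) :
  (size (\prod_(a <- rs) (1 - a%:P * 'X))%R <= (size rs).+1)%N /\
  forall i j, (i + j)%N = size rs ->
    (\prod_(a <- rs) (1 - a%:P * 'X))`_i = (\prod_(a <- rs) ('X - a%:P))`_j.
Proof.
elim: rs => [|a rs [IHs IHc]].
  rewrite !big_nil size_poly1; split => // i j /eqP; rewrite addn_eq0.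
  by move=> /andP[/eqP-> /eqP->].
rewrite !big_cons; set B := \prod_(a <- rs) _ in IHs IHc *.
set A := \prod_(a <- rs) _ in IHc *.
have sA : size A = (size rs).+1 by rewrite size_prod_XsubC.
have cB i : ((1 - a%:P * 'X) * B)`_i = B`_i - a * (if i is i'.+1 then B`_i' else 0).
  by rewrite mulrBl mul1r coefB -mulrA coefCM coefXM; case: i.
have cA i : (('X - a%:P) * A)`_i = (if i is i'.+1 then A`_i' else 0) - a * A`_i.
  by rewrite mulrBl coefB coefXM coefCM; case: i.
split.
  apply/leq_sizeP => -[|i] //= si; rewrite cB.
  by rewrite !nth_default ?mulr0 ?subr0 //; apply: leq_trans IHs _; lia.
move=> i j /= ij; rewrite cA cB; case: i j ij => [|i] [|j] //= ij.
- rewrite mulr0 subr0 [A`_j.+1]nth_default ?mulr0 ?subr0; last by rewrite sA; lia.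
  apply: IHc; lia.
- rewrite [B`_i.+1]nth_default; last by apply: leq_trans IHs _; lia.
  by rewrite !sub0r; congr (- (_ * _)); apply: IHc; lia.
- by congr (_ - _ * _); apply: IHc; lia.
Qed.

Section Blaschke.
Variable R : rcfType.
Local Notation C := R[i].

(** Energy balance for one step of multiplication by the Blaschke factor [(X - a) / (1 - conj(a) X)
    = - a + (1 - |a|^2) X / (1 - conj(a) X)]: [s] is the input coefficient, [w] the state, and
    [conjc a * w + s] the next state. *)
Lemma blaschke_step (a s w : C) :
  normc (- a * s + (1 - normc a ^+ 2)%:C * w) ^+ 2
    + (1 - normc a ^+ 2) * normc (conjc a * w + s) ^+ 2
  = normc s ^+ 2 + (1 - normc a ^+ 2) * normc w ^+ 2.
Proof.
case: a s w => [a b] [c d] [x y].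
have n2 (u v : R) : normc (u +i* v) ^+ 2 = u ^+ 2 + v ^+ 2.
  by rewrite /= sqr_sqrtr // addr_ge0 // sqr_ge0.
rewrite n2; simpc; rewrite !n2; ring.
Qed.

Lemma blaschke_contraction (a : C) (s : {poly C}) N : normc a < 1 ->
  exists t : {poly C},
    eqmodX N ((1 - (conjc a)%:P * 'X) * t) (('X - a%:P) * s) /\
    \sum_(k < N) normc t`_k ^+ 2 <= \sum_(k < N) normc s`_k ^+ 2.
Proof.
move=> a1.
(* [w] lists the coefficients of [s] times [X / (1 - conj(a) X)]. Summing the energy balance leaves
   only the nonnegative energy of the final state. *)
pose w := fix w k := if k is k'.+1 then conjc a * w k' + s`_k' else 0.
pose t k := - a * s`_k + (1 - normc a ^+ 2)%:C * w k.
exists (\poly_(k < N) t k); split.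
  move=> i iN; rewrite !mulrBl mul1r !coefB -mulrA !coefCM !coefXM !coef_poly iN.
  case: i iN => [|i] iN /=.
    by rewrite mulr0 subr0 sub0r /t /= mulr0 addr0 mulNr.
  rewrite (ltnW iN) /t /=.
  have -> : (1 - normc a ^+ 2)%:C = 1 - a * conjc a.
    by rewrite rmorphB rmorphXn -sqr_normc.
  by ring.
have h n : \sum_(k < n) normc (t k) ^+ 2 + (1 - normc a ^+ 2) * normc (w n) ^+ 2
   = \sum_(k < n) normc s`_k ^+ 2.
  elim: n => [|n IH]; first by rewrite !big_ord0 normc0 expr0n mulr0 addr0.
  rewrite !big_ord_recr /= -IH -addrA blaschke_step; ring.
rewrite -h (eq_bigr (fun k : 'I_N => normc (t k) ^+ 2)).
  rewrite lerDl mulr_ge0 ?sqr_ge0 // subr_ge0 exprn_ile1 ?normc_ge0 //; exact: ltW.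
by move=> k _; rewrite coef_poly ltn_ord.
Qed.

Lemma blaschke_product (rs : seq C) N : all (fun a => normc a < 1) rs ->
  exists t : {poly C},
    eqmodX N (\prod_(a <- rs) (1 - (conjc a)%:P * 'X) * t)
      (\prod_(a <- rs) ('X - a%:P)) /\
    \sum_(k < N) normc t`_k ^+ 2 <= 1.
Proof.
elim: rs => [_|a rs IH /= /andP[a1 /IH[s [sP sN]]]].
  exists 1; rewrite !big_nil mulr1; split=> //.
  case: N => [|N]; first by rewrite big_ord0.
  rewrite big_ord_recl big1 ?addr0 => [|i _].
    by rewrite coef1 normc1 expr1n.
  by rewrite coef1 normc0 expr0n.
have [t [tP tN]] := blaschke_contraction s N a1.
exists t; rewrite !big_cons; split; last exact: le_trans sN.
rewrite mulrAC -mulrA mulrC; set B := \prod_(i <- rs) _ in sP *.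
rewrite mulrC.
apply: (@eqmodX_trans _ _ (('X - a%:P) * s * B)).
  by rewrite mulrA; apply: eqmodXM.
by rewrite -mulrA [s * B]mulrC; apply: eqmodXM.
Qed.

End Blaschke.

(** * No Pisot number is smaller than the fourth root of 2 *)

Lemma normc_int_ge1 (R : rcfType) (n : int) : n != 0 -> 1 <= normc (n%:~R : R[i]).
Proof.
move=> n0; have -> : n%:~R = (n%:~R)%:C :> R[i] by rewrite rmorph_int.
by rewrite normc_real -intr_norm ler1z -gtz0_ge1 normr_gt0.
Qed.

Lemma normc_int_lt2 (R : rcfType) (n : int) :
  normc (n%:~R : R[i]) < 2 -> normc (n%:~R : R[i]) <= 1.
Proof.
have -> : n%:~R = (n%:~R)%:C :> R[i] by rewrite rmorph_int.
rewrite normc_real -intr_norm -[2]/(2%:~R) -[1]/(1%:~R) ltr_int ler_int; lia.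
Qed.

Lemma quartic_bound (R : realFieldType) (Q c : R) :
  1 < Q -> Q ^+ 4 < 2 -> c * Q = 1 -> 1 < c ^+ 2 + (c - (1 - c ^+ 2)) ^+ 2 /\
  0 < c - (1 - c ^+ 2) /\ 0 < c < 1.
Proof.
move=> Q1 Q4 cQ.
have c0 : 0 < c by rewrite -(pmulr_lgt0 c (lt_trans ltr01 Q1)) cQ.
have c1 : c < 1 by rewrite -cQ ltr_pMr.
have c4 : 1 < c ^+ 4 * 2.
  have e : c ^+ 4 * Q ^+ 4 = 1 by rewrite -exprMn cQ expr1n.
  by rewrite -[ltLHS]e ltr_pM2l // exprn_gt0.
(* The fractions are chosen so that [(12/17)^2 < 1/2], [(21/25)^2 < 12/17],
   [12/17 + 21/25 - 1 > 6/11] and [12/17 + (6/11)^2 > 1]. *)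
have x7 : 12 / 17 < c ^+ 2.
  rewrite ltNge; apply/negP => le.
  suff : (c ^+ 2) ^+ 2 <= (12 / 17) ^+ 2 by rewrite -exprM; lra.
  by rewrite ler_sqr // nnegrE ?sqr_ge0 //; lra.
have y8 : 21 / 25 < c.
  rewrite ltNge; apply/negP => le; suff : c ^+ 2 <= (21 / 25) ^+ 2 by lra.
  by rewrite ler_sqr // nnegrE; lra.
split; last by split; [lra|rewrite c0].
have : (6 / 11) ^+ 2 < (c - (1 - c ^+ 2)) ^+ 2.
  by rewrite ltr_sqr ?nnegrE; lra.
lra.
Qed.

(** With [U = P / Ps] and [G] the Blaschke product, [G = U (1 - Q X) / (X - Q)]. A nonconstant
    coefficient of the integer series [U] would force two coefficients of [G] with squares summing
    to more than 1. So [P] is a multiple of its reciprocal [Ps]; then all roots in [rs] equal [1/Q],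
    and [P.[1]] is a nonzero integer of modulus below 1. *)
Lemma small_pisot_false (R : realType) (Q : R) (P : {poly int}) (rs : seq R[i]) :
  1 < Q -> Q ^+ 4 < 2 -> P \is monic -> P`_0 != 0 -> P.[1] != 0 ->
  map_poly intr P = ('X - Q%:C%:P) * \prod_(a <- rs) ('X - a%:P) ->
  all (fun a => normc a < 1) rs -> False.
Proof.
move=> Q1 Q42 Pm P0 P1 PE rs1.
have Q0 : 0 < Q by exact: lt_trans Q1.
have Q2 : Q < 2.
  apply: le_lt_trans Q42; rewrite -[leLHS]expr1 ler_weXn2l //; exact: ltW.
set n := size P; pose Ps := \poly_(i < n) P`_(n.-1 - i).
pose toC := map_poly (intr : int -> R[i]).
have sP : n = (size rs).+2.
  rewrite /n -(size_map_inj_poly (f := intr : int -> R[i])) //; last exact: intr_inj.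
  have -> : map_poly intr P = \prod_(a <- Q%:C :: rs) ('X - a%:P) by rewrite big_cons.
  by rewrite size_prod_XsubC.
(* [Ps] has integer coefficients, hence is fixed by conjugation; this puts the conjugates [conjc a]
   into its factors, as in the Blaschke denominators. *)
have PsE : toC Ps = (1 - Q%:C%:P * 'X) * \prod_(a <- rs) (1 - (conjc a)%:P * 'X).
  have -> : toC Ps = map_poly conjc (toC Ps).
    by rewrite /toC -map_poly_comp; apply: eq_map_poly => k /=; rewrite rmorph_int.
  have -> : toC Ps = \prod_(a <- Q%:C :: rs) (1 - a%:P * 'X).
    have [sz cf] := prod_XsubC_rev (Q%:C :: rs).
    apply/polyP => i; rewrite coef_map coef_poly; case: ltnP => [ni|ni].
      rewrite (cf i (n.-1 - i)%N) ?big_cons -?PE ?coef_map // sP /=.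
      by rewrite subnKC // -ltnS -sP.
    by rewrite nth_default //; apply: leq_trans sz _; rewrite -sP.
  rewrite big_cons rmorphM rmorph_prod /= !rmorphB rmorph1 rmorphM /= map_polyX.
  rewrite map_polyC /= oppr0; congr (_ * _); apply: eq_bigr => a _.
  by rewrite rmorphB rmorph1 rmorphM /= map_polyX map_polyC.
have Ps0 : Ps`_0 = 1.
  rewrite coef_poly sP /= subn0 -[RHS](monicP Pm) lead_coefE.
  by rewrite -/n sP.
(* Both [P] and [Ps] have size at most [n], so a congruence at this precision determines them. *)
pose N := n.
have [V VP] := eqmodX_inv N Ps0.
have [U UP] : exists U, eqmodX N (Ps * U) P.
  exists (P * V); rewrite mulrCA -[X in eqmodX _ _ X]mulr1; exact: eqmodXM.
have [G [GP GN]] := blaschke_product N rs1.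
have GU : eqmodX N (('X - Q%:C%:P) * G) ((1 - Q%:C%:P * 'X) * toC U).
  have h1 : eqmodX N (toC Ps * (('X - Q%:C%:P) * G))
      (toC Ps * ((1 - Q%:C%:P * 'X) * toC U)).
    have -> : toC Ps * ((1 - Q%:C%:P * 'X) * toC U) =
        (1 - Q%:C%:P * 'X) * toC (Ps * U).
      by rewrite /toC rmorphM /= mulrCA.
    apply: (@eqmodX_trans _ _ ((1 - Q%:C%:P * 'X) * toC P)); last first.
      by apply: eqmodXM => //; exact: eqmodX_sym (eqmodX_map _ UP).
    rewrite /toC PE -/(toC Ps) PsE -!mulrA; apply: eqmodXM => //.
    by rewrite mulrCA; apply: eqmodXM.
  have VC : eqmodX N (toC V * toC Ps) 1.
    by rewrite -(rmorph1 (map_poly intr)) -rmorphM mulrC; exact: eqmodX_map.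
  have inv (x : {poly R[i]}) : eqmodX N (toC V * (toC Ps * x)) x.
    by rewrite mulrA -[X in eqmodX _ _ X]mul1r; apply: eqmodXM.
  apply: eqmodX_trans (eqmodX_sym (inv _)) _.
  by apply: eqmodX_trans (inv _); apply: eqmodXM.
pose c := Q^-1; have cQ : c * Q = 1 by rewrite mulVf // gt_eqF.
have [cc [cd /andP[c0 c1]]] := quartic_bound Q1 Q42 cQ.
have cQC : c%:C * Q%:C = 1 by rewrite -rmorphM cQ.
(* Comparing coefficients in [GU] gives a recurrence for [G] driven by [U]. *)
have GUc k : (k < N)%N -> G`_k = c%:C *
    ((if k is k'.+1 then G`_k' + Q%:C * (U`_k')%:~R else 0) - (U`_k)%:~R).
  move=> kN; have := GU k kN.
  rewrite !mulrBl mul1r !coefB -mulrA !coefCM !coefXM !coef_map /=.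
  case: k kN => [|k] kN /= e.
    have -> : (U`_0)%:~R = - (Q%:C * G`_0).
      by rewrite -[LHS]subr0 -[X in _ - X](mulr0 Q%:C) -e sub0r.
    by rewrite sub0r opprK mulrA cQC mul1r.
  have -> : G`_k = Q%:C * G`_k.+1 + ((U`_k.+1)%:~R - Q%:C * (U`_k)%:~R).
    by rewrite -e; ring.
  rewrite -[LHS]mul1r -cQC; ring.
have Nn : (1 < N)%N by rewrite /N sP.
set e := U`_0; have eE : e = P`_0.
  have := UP 0%N (ltnW Nn); rewrite coefM big_ord_recl big_ord0 /= addr0 Ps0 mul1r.
  by [].
have G0 : G`_0 = - (c%:C * e%:~R) by rewrite GUc ?(ltnW Nn) // sub0r mulrN.
have two k : (0 < k < N)%N -> normc G`_0 ^+ 2 + normc G`_k ^+ 2 <= 1.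
  move=> /andP[k0 kN]; apply: le_trans GN.
  rewrite (bigD1 (Ordinal (ltnW Nn))) //= lerD2l (bigD1 (Ordinal kN)) /=; last first.
    by rewrite -val_eqE /= -lt0n.
  by rewrite lerDl; apply: sumr_ge0 => j _; exact: sqr_ge0.
have nG0 : normc G`_0 = c * normc (e%:~R : R[i]).
  by rewrite G0 normcN normcM normc_real gtr0_norm.
have e1 : normc (e%:~R : R[i]) = 1.
  apply/eqP; rewrite eq_le normc_int_ge1 ?eE // andbT -eE.
  have : c * normc (e%:~R : R[i]) <= 1.
    rewrite -nG0 -(@expr_le1 _ 2) ?normc_ge0 //.
    by apply: le_trans (two 1%N Nn); rewrite lerDl sqr_ge0.
  rewrite mulrC ler_pdivrMr // mul1r => eQ.
  exact: normc_int_lt2 (le_lt_trans eQ Q2).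
(* For the first positive [k] with [U_k != 0], the recurrence gives
   [G_k = e (1 - c^2) c^(k-1) - c U_k], of modulus at least [c - (1 - c^2)], while [|G_0| = c];
   [quartic_bound] makes the energy exceed 1. *)
case: (pselect (exists k, (0 < k < N)%N && (U`_k != 0))) => [ex|nex].
  have [k /andP[k0N Uk] kmin] := ex_minnP ex.
  have /andP[k0 kN] := k0N.
  have z i : (0 < i < k)%N -> U`_i = 0.
    move=> /andP[i0 ik]; apply/eqP; apply: contraT => u.
    by have := kmin i; rewrite i0 (ltn_trans ik kN) u leqNgt ik => /(_ isT).
  have Gj j : (j.+1 < k)%N -> G`_j.+1 = e%:~R * (1 - c ^+ 2)%:C * c%:C ^+ j.
    elim: j => [|j IH] jk; rewrite GUc ?(ltn_trans jk) //.
      by rewrite (z 1%N) ?jk // G0 -/e rmorphB rmorphXn /= subr0 mulrDr mulrA cQC; ring.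
    rewrite IH ?(ltnW jk) // (z j.+1) ?(ltnW jk) // (z j.+2) ?jk //.
    by rewrite mulr0 addr0 subr0 mulrCA -exprS.
  have Gk : G`_k = e%:~R * (1 - c ^+ 2)%:C * c%:C ^+ k.-1 - c%:C * (U`_k)%:~R.
    case: k k0N k0 kN Uk kmin z Gj => // -[|k] k0N k0 kN Uk kmin z Gj.
      rewrite GUc // G0 -/e rmorphB rmorphXn /= mulrBr mulrDr mulrA cQC; ring.
    by rewrite GUc // Gj // z ?ltnSn // mulr0 addr0 mulrBr mulrCA -exprS.
  have := two k k0N; rewrite nG0 e1 mulr1; apply/negP; rewrite -ltNge.
  apply: lt_le_trans cc _; rewrite lerD2l ler_sqr ?nnegrE ?(ltW cd) ?normc_ge0 //.
  have t1 : c <= normc (c%:C * (U`_k)%:~R).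
    rewrite normcM normc_real gtr0_norm // ler_peMr ?(ltW c0) //.
    exact: normc_int_ge1.
  have t2 : normc (e%:~R * (1 - c ^+ 2)%:C * c%:C ^+ k.-1) <= 1 - c ^+ 2.
    have c2 : 0 <= 1 - c ^+ 2 by rewrite subr_ge0 exprn_ile1 // ltW.
    rewrite !normcM e1 mul1r normcX !normc_real (gtr0_norm c0).
    by rewrite (ger0_norm c2) ler_piMr // exprn_ile1 // ltW.
  have := normc_dist (c%:C * (U`_k)%:~R) (e%:~R * (1 - c ^+ 2)%:C * c%:C ^+ k.-1).
  rewrite normc_distC -Gk; lra.
have PPs : P = e *: Ps.
  have Ue : eqmodX N U e%:P.
    move=> [|i] iN; rewrite coefC //=; apply/eqP; apply: contraT => u.
    by case: nex; exists i.+1; rewrite iN u.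
  apply/polyP => i; case: (ltnP i n) => ni.
    by rewrite -UP // -mul_polyC [e%:P * _]mulrC; exact: (eqmodXM _ Ue ni).
  by rewrite nth_default // coefZ coef_poly ltnNge ni /= mulr0.
(* A root of [Ps] is [1/Q] or the inverse of some [conjc b] with [b] in [rs]; the latter lies
   outside the unit disc. *)
have rsc a : a \in rs -> a = c%:C.
  move=> ars; have ra : (toC Ps).[a] = 0.
    have : (toC P).[a] = 0.
      rewrite /toC PE hornerM horner_prod (big_rem a) //=.
      by rewrite [('X - a%:P).[a]]hornerXsubC subrr mul0r mulr0.
    rewrite PPs /toC linearZ /= hornerZ => /eqP; rewrite mulf_eq0 => /orP[|/eqP //].
    by rewrite intr_eq0 eE (negbTE P0).
  move: ra; rewrite PsE hornerM horner_prod => /eqP; rewrite mulf_eq0 => /orP[|].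
    rewrite !hornerE subr_eq0 => /eqP Qa.
    by rewrite -[a]mul1r -cQC -mulrA -Qa mulr1.
  rewrite prodf_seq_eq0 => /hasP[b brs]; rewrite /= !hornerE subr_eq0 => /eqP ba.
  have a1 : normc a < 1 by exact: (allP rs1).
  have b1 : normc (conjc b) < 1.
    have -> : normc (conjc b) = normc b.
      by apply: complexI; have := normcJ b; rewrite !normr_normc.
    exact: (allP rs1).
  have : normc (conjc b * a) < 1.
    by rewrite normcM mulr_ilt1 ?normc_ge0.
  by rewrite -ba normc1 ltxx.
have : normc ((P.[1])%:~R : R[i]) < 1.
  have -> : (P.[1])%:~R = (toC P).[1] :> R[i].
    by rewrite /toC -[1]/(1%:~R) horner_map.
  rewrite /toC PE hornerM horner_prod !hornerE normcM.
  have -> : 1 - Q%:C = (1 - Q)%:C by rewrite rmorphB.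
  rewrite normc_real ltr0_norm ?subr_lt0 // opprB.
  have le : normc (\prod_(a <- rs) ('X - a%:P).[1]) <= 1.
    rewrite big_seq; elim/big_ind: _ => [|x y x1 y1|a /rsc ->].
    - by rewrite normc1.
    - by rewrite normcM mulr_ile1 ?normc_ge0.
    - rewrite !hornerE; have -> : 1 - c%:C = (1 - c)%:C by rewrite rmorphB.
      by rewrite normc_real ger0_norm; lra.
  by apply: le_lt_trans (ler_piMr _ le) _; lra.
by apply/negP; rewrite -leNgt normc_int_ge1.
Qed.

(** * Minimal polynomials and the failure of separation *)

Lemma eval_at_ratr (F : numFieldType) (x : F) (f : {poly int}) :
  (map_poly ratr (map_poly intr f)).[x] = eval_at x f.
Proof.
rewrite /eval_at -map_poly_comp; congr (_.[_]).
by apply: eq_map_poly => k /=; rewrite ratr_int.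
Qed.

(** The minimal rational polynomial of [x] divides [D]; by Gauss's lemma an integer multiple [p1]
    divides [D] over the integers. Its leading coefficient divides a unit, so it is 1 or -1, and
    multiplying by it makes [p1] monic. *)
Lemma minimal_int_poly (F : numFieldType) (x : F) (D : {poly int}) :
  eval_at x D = 0 -> lead_coef D \is a GRing.unit ->
  exists P : {poly int}, [/\ P \is monic, eval_at x P = 0,
    forall f, eval_at x f = 0 -> f != 0 -> (size P <= size f)%N &
    forall (K : numFieldType) (al : K) f,
      eval_at x f = 0 -> eval_at al P = 0 -> eval_at al f = 0].
Proof.
move=> Dx uD; have D0 : D != 0 by apply: contraTneq uD => ->; rewrite lead_coef0 unitr0.
pose vanish (p : {poly rat}) := (p != 0) && ((map_poly ratr p).[x] == 0).
have ex : exists n, `[< exists2 p, vanish p & size p = n >].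
  exists (size D); apply/asboolP; exists (map_poly intr D).
    rewrite /vanish eval_at_ratr Dx eqxx.
    by rewrite map_poly_eq0_id0 ?intr_eq0 ?lead_coef_eq0 ?D0.
  exact: size_rat_int_poly.
have [n /asboolP[p /andP[p0 px] sp] minn] := ex_minnP ex.
have pmin (g : {poly rat}) : g != 0 -> (map_poly ratr g).[x] = 0 -> (size p <= size g)%N.
  move=> g0 gx; rewrite sp; apply: minn; apply/asboolP; exists g => //.
  by rewrite /vanish g0 gx eqxx.
have pdvd (g : {poly rat}) : (map_poly ratr g).[x] = 0 -> (p %| g)%R.
  move=> gx; rewrite /dvdp; apply: contraT => r0.
  have := pmin _ r0; rewrite leqNgt ltn_modp p0; apply.
  move: gx; rewrite {1}(divp_eq g p) rmorphD rmorphM hornerD hornerM /= (eqP px).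
  by rewrite mulr0 add0r.
have [p1 [a a0 pE] [r Dr]] := dvdpP_rat_int (pdvd _ (etrans (eval_at_ratr x D) Dx)).
set l := lead_coef p1.
have ul : l \is a GRing.unit.
  by move: uD; rewrite Dr lead_coefM unitrM => /andP[].
have l0 : l != 0 by apply: contraTneq ul => ->; rewrite unitr0.
have evP (K : numFieldType) (z : K) :
    ((map_poly ratr p).[z] == 0) = (eval_at z p1 == 0).
  rewrite pE map_polyZ hornerZ eval_at_ratr mulf_eq0 fmorph_eq0.
  by rewrite (negbTE a0).
have evZ (K : numFieldType) (z : K) : eval_at z (l *: p1) = l%:~R * eval_at z p1.
  by rewrite /eval_at map_polyZ hornerZ.
exists (l *: p1); split.
- rewrite monicE lead_coefZ -/l -expr2; by case/orP: ul => /eqP ->.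
- by rewrite evZ; move: px; rewrite evP => /eqP ->; rewrite mulr0.
- move=> f fx f0; rewrite size_scale // -size_rat_int_poly.
  rewrite -(size_scale _ a0) -pE -(size_rat_int_poly f); apply: pmin.
    by rewrite map_poly_eq0_id0 ?intr_eq0 ?lead_coef_eq0 ?f0.
  by rewrite eval_at_ratr.
move=> K al f fx /eqP; rewrite evZ mulf_eq0 intr_eq0 (negbTE l0) /= => Pal.
have /dvdpP[h hE] := pdvd _ (etrans (eval_at_ratr x f) fx).
rewrite -eval_at_ratr hE rmorphM hornerM /= [X in _ * X](_ : _ = 0) ?mulr0 //.
by apply/eqP; rewrite evP.
Qed.

(** Under separation every specialization other than [Q] has modulus below 1, which excludes 1.
    Hence two digit polynomials agree at [Q] but not at 1, [Q] is an algebraic integer, and its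
    minimal polynomial contradicts [small_pisot_false]. *)
Lemma not_separated (R : realType) (Q eta : R) :
  1 < Q -> Q ^+ 4 < 2 -> 0 < eta -> ~ digits_separated Q eta.
Proof.
move=> Q1 Q42 eta0 sep.
have conj al := @conjugate_norm_lt1 R Q Q1 Q42 eta al eta0 sep.
have not1 : ~ specializes Q (1 : R[i]).
  move=> /conj; rewrite normc1 ltxx => h; suff /h : 1 != Q%:C by [].
  by apply: contraTneq Q1 => -[<-]; rewrite ltxx.
have [a [b [da db ab ab1]]] : exists a b, [/\ digits residue123 a, digits residue123 b,
     eval_at Q a = eval_at Q b & eval_at (1 : R[i]) a != eval_at 1 b].
  apply: contrapT => h; apply: not1 => a b da db ab; apply/eqP; apply: contraT => ne.
  by case: h; exists a, b.
have D0 : a - b != 0.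
  by apply: contraNneq ab1 => /subr0_eq ->.
(* A nonzero difference of digits is 1 or -1. *)
have uD : lead_coef (a - b) \is a GRing.unit.
  move: D0; rewrite -lead_coef_eq0 lead_coefE coefB.
  move: (size (a - b)).-1 => n.
  by case: (da n) => [->|[_ ->]]; case: (db n) => [->|[_ ->]].
have Dx : eval_at Q (a - b) = 0 by rewrite eval_atB ab subrr.
have [P [Pm PQ Pmin Pdvd]] := minimal_int_poly Dx uD.
have P0 : P != 0 by exact: monic_neq0.
have sp al : eval_at al P = 0 -> specializes Q al.
  move=> Pal u v du dv uv; apply: subr0_eq; rewrite -eval_atB.
  by apply: Pdvd Pal; rewrite eval_atB uv subrr.
have PQC : eval_at Q%:C P = 0 by rewrite (eval_at_rmorph (real_complex R)) PQ rmorph0.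
have [rs0 rsE] := closed_field_poly_normal (map_poly intr P : {poly R[i]}).
have lP : lead_coef (map_poly intr P : {poly R[i]}) = 1.
  rewrite lead_coef_map_inj //; last exact: intr_inj.
  by rewrite (monicP Pm).
rewrite lP scale1r in rsE.
have Qrs : Q%:C \in rs0.
  by rewrite -root_prod_XsubC -rsE /root; apply/eqP.
have sP : (1 < size P)%N.
  rewrite -(size_map_inj_poly (f := intr : int -> R[i])) //; last exact: intr_inj.
  by rewrite rsE size_prod_XsubC; case: (rs0) Qrs.
have perm := perm_to_rem Qrs; set rs := rem _ _ in perm.
rewrite (perm_big _ perm) big_cons in rsE.
apply: (small_pisot_false Q1 Q42 Pm _ _ rsE).
- apply/eqP => P00; have PX : P = drop_poly 1 P * 'X.
    rewrite -{1}(poly_take_drop 1 P) expr1 [X in X + _](_ : _ = 0) ?add0r //.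
    by apply/polyP => -[|k]; rewrite coef_take_poly coef0.
  have d0 : drop_poly 1 P != 0 by apply: contraNneq P0 => e; rewrite PX e mul0r.
  suff /Pmin/(_ d0) : eval_at Q (drop_poly 1 P) = 0 by rewrite {1}PX size_mulX // ltnn.
  move: PQ; rewrite {1}PX eval_atM -['X]expr1 eval_atXn => /eqP.
  by rewrite mulf_eq0 expr1 (gt_eqF (lt_trans ltr01 Q1)) orbF => /eqP.
- apply/eqP => P1; apply: not1; apply: sp.
  by rewrite /eval_at -[1]/(1%:~R) horner_map P1.
- apply/allP => al alrs.
  have Pal : eval_at al P = 0.
    rewrite /eval_at rsE hornerM horner_prod (big_rem al) //=.
    by rewrite [('X - al%:P).[al]]hornerXsubC subrr mul0r mulr0.
  apply: (conj al (sp _ Pal)); apply: contraTneq sP => alQ.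
  (* A second occurrence of [Q] among the roots would make the derivative vanish at [Q], against the
     minimality of [P]. *)
  have dP : eval_at Q P^`() = 0.
    apply: complexI; rewrite -(eval_at_rmorph (real_complex R)) rmorph0.
    rewrite /eval_at -deriv_map rsE (big_rem al) //= alQ.
    by rewrite !derivM !derivXsubC !hornerE subrr !mul0r !add0r.
  rewrite -leqNgt; have := Pmin _ dP; case: eqVneq => [d0 _|_ /(_ isT)].
    have := congr1 (fun g : {poly int} => g`_(size P).-2) d0.
    rewrite coef0 coef_deriv; move: (monicP Pm); rewrite lead_coefE.
    by case: (size P) => [|[|n]] //= -> /eqP; rewrite pnatr_eq0.
  by rewrite leqNgt lt_size_deriv.
Qed.

(** * Small gaps at infinity *)

Section Density.
Variables (R : realType) (Q : R).
Hypotheses (Q1 : 1 < Q) (Q42 : Q ^+ 4 < 2).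

Let Q0 : 0 < Q. Proof. exact: lt_trans Q1. Qed.

(** Multiplying a tiny difference by powers of [Q ^+ 4] preserves the residue classes. Each factor
    is below 2, so the first product to reach [delta / 2] is still below [delta]. The initial
    difference is so small that exponents at least [4 * n] can be reached without overshooting. *)
Lemma small_step (n : nat) (delta : R) : 0 < delta -> exists a b,
  [/\ digits (fun i => residue123 i && (4 * n <= i)%N) a,
      digits (fun i => residue123 i && (4 * n <= i)%N) b &
      delta / 2 <= eval_at Q a - eval_at Q b < delta].
Proof.
move=> d0; have Qn : 0 < Q ^+ (4 * n) by rewrite exprn_gt0.
have [a [b [da db ab]]] : exists a b, [/\ digits residue123 a, digits residue123 b &
    0 < eval_at Q a - eval_at Q b < delta / Q ^+ (4 * n)].
  apply: contrapT => h; apply: (not_separated Q1 Q42 (divr_gt0 d0 Qn)) => a b da db.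
  wlog lt : a b da db / eval_at Q b < eval_at Q a => [wl|_].
    move=> ne; case: (ltgtP (eval_at Q b) (eval_at Q a)) => [lt|lt|e].
    - exact: wl.
    - by rewrite distrC; apply: wl => //; rewrite eq_sym.
    - by rewrite e eqxx in ne.
  rewrite gtr0_norm ?subr_gt0 // leNgt; apply/negP => lt'.
  by apply: h; exists a, b; split=> //; rewrite subr_gt0 lt.
set eta := eval_at Q a - eval_at Q b in ab.
case/andP: ab => eta0; rewrite ltr_pdivlMr // => etad.
pose big k := delta / 2 <= eta * Q ^+ (4 * (n + k)).
have ex : exists k, big k.
  have [k kP] := exists_exprn_gt Q1 (delta / 2 / eta); exists k.
  rewrite /big -ler_pdivrMl // mulrC (le_trans (ltW kP)) //.
  by rewrite ler_weXn2l ?(ltW Q1) //; lia.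
have [k kb kmin] := ex_minnP ex.
have shift u : digits residue123 u ->
    digits (fun i => residue123 i && (4 * n <= i)%N) ('X^(4 * (n + k)) * u).
  by clear; apply: digitsXn => i; rewrite /residue123 /residue; lia.
exists ('X^(4 * (n + k)) * a), ('X^(4 * (n + k)) * b); split; [exact: shift..|].
rewrite !eval_atM !eval_atXn -mulrBr -/eta [_ * eta]mulrC.
apply/andP; split; first exact: kb.
case: k kb kmin {shift} => [|k] kb kmin; first by rewrite addn0.
have : ~~ big k by apply/negP => /kmin; rewrite ltnn.
rewrite /big -ltNge addnS mulnS exprD [Q ^+ 4 * _]mulrC mulrA.
have : 0 < eta * Q ^+ (4 * (n + k)) by rewrite mulr_gt0 // exprn_gt0.
set x := eta * _ => e lt.
have : x * Q ^+ 4 < x * 2 by rewrite ltr_pM2l.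
lra.
Qed.

(** To append a step, [b] is added to every old term, which keeps the old differences, and the new
    last term is [g N + a]. The exponents of [a] and [b] lie beyond those of the old terms. *)
Lemma small_step_chain (N : nat) (delta : R) : 0 < delta ->
  exists g : nat -> {poly int}, (forall i, digits residue123 (g i)) /\
    forall i, (i < N)%N -> delta / 2 <= eval_at Q (g i.+1) - eval_at Q (g i) < delta.
Proof.
move=> d0; elim: N => [|N [g [gd gs]]].
  by exists (fun=> 0); split=> // i; exact: digits0.
pose n := \max_(i < N.+1) size (g i).
have [a [b [da db ab]]] := small_step n d0.
exists (fun i => if (i <= N)%N then g i + b else g N + a).
have add (i : 'I_N.+1) u : digits (fun i => residue123 i && (4 * n <= i)%N) u ->
    digits residue123 (g i + u).
  move=> du; have sg : (size (g i) <= 4 * n)%N.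
    apply: (@leq_trans n); last by rewrite leq_pmull.
    exact: (@leq_bigmax _ (fun j : 'I_N.+1 => size (g j)) i).
  apply: digitsD (digits_cut sg (gd i)) du => j /=.
  - by case/andP.
  - by case/andP.
  - by move=> /andP[_ ?] /andP[_]; rewrite leqNgt => /negP.
split=> [i|i iN]; first by case: (leqP i N) => iN;
  [exact: (add (Ordinal (iN : (i < N.+1)%N)))|exact: (add ord_max)].
rewrite (iN : (i <= N)%N); case: (ltnP i N) => iN'.
  by rewrite !eval_atD opprD addrACA subrr addr0 gs.
have -> : i = N by apply/eqP; rewrite eqn_leq iN' -ltnS iN.
by rewrite !eval_atD opprD addrACA subrr add0r.
Qed.

(** Class 0 approximates [t - eval_at Q (g 0)] within 1; a chain in the other classes, with steps
    below [delta] and total length above 1, then fills the remaining gap. *)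
Lemma digits_dense (delta : R) : 0 < delta -> exists A, forall t, A <= t ->
  exists2 y, digits xpredT y & eval_at Q y <= t < eval_at Q y + delta.
Proof.
move=> d0; pose N := Num.bound (2 / delta).
have N1 : 1 < N%:R * (delta / 2).
  have : 2 / delta < N%:R by apply: archi_boundP; rewrite divr_ge0 // ltW.
  by rewrite ltr_pdivrMr //; lra.
have [g [gd gs]] := small_step_chain N d0.
exists (eval_at Q (g 0%N)) => t tA.
have [|y yd yt] := gap0 Q1 Q42 (x := t - eval_at Q (g 0%N)).
  by rewrite subr_ge0.
have gN i : (i <= N)%N -> eval_at Q (g 0%N) + i%:R * (delta / 2) <= eval_at Q (g i).
  elim: i => [|i IH] iN; first by rewrite mul0r addr0.
  by have := IH (ltnW iN); have := gs i iN; rewrite -(natr1 i) mulrDl; lra.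
have ex : exists i, (i <= N)%N && (eval_at Q (g i) <= t - eval_at Q y).
  by exists 0%N => /=; lra.
have [//|i /andP[iN ig] imax] := ex_maxnP (m := N) ex _; first by move=> j /andP[].
have iN' : (i < N)%N.
  rewrite ltn_neqAle iN andbT; apply/eqP => e; rewrite e in ig.
  by have := gN N (leqnn N); lra.
exists (y + g i).
  by apply: digitsD yd (gd i) => // j; rewrite /residue123 => -> .
rewrite eval_atD.
have : ~~ (eval_at Q (g i.+1) <= t - eval_at Q y).
  by apply/negP => h; have := imax i.+1; rewrite iN' h ltnn => /(_ isT).
rewrite -ltNge; have := gs i iN'; lra.
Qed.

(** The first [M] digits are chosen so that, after subtraction of the block value [beta], the
    remainder lies between one and two thirds of [Q ^- B]; rescaled, it lies well inside the unit
    interval. Allowing every large [M] lets several coordinates share the same position. *)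
Lemma steer_block (t : R) (e : nat -> bool) (B : nat) : 0 < t < 1 ->
  exists M0, forall M, (M0 <= M)%N -> exists (d : nat -> bool) (t' : R),
    [/\ 0 < t' < 1, forall l, (l < B)%N -> d (M + l)%N = e l &
        t = \sum_(l < M + B) (d l)%:R * Q ^- l.+1 + Q ^- (M + B) * t'].
Proof.
move=> /andP[t0 t1].
have QV n : 0 < Q ^- n by rewrite invr_gt0 exprn_gt0.
set beta : R := \sum_(l < B) (e l)%:R * Q ^- l.+1.
have beta0 : 0 <= beta by apply: sumr_ge0 => l _; rewrite mulr_ge0 // ltW.
have [|A AP] := @digits_dense (Q ^- B / 3); first by rewrite divr_gt0.
have [M0 M0P] := exists_exprn_gt Q1 ((A + beta + Q ^- B / 3) / t).
exists M0 => M M0M.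
have [|y yd yt] := AP (Q ^+ M * t - beta - Q ^- B / 3).
  have : (A + beta + Q ^- B / 3) / t < Q ^+ M.
    by apply: lt_le_trans M0P _; rewrite ler_weXn2l // ltW.
  by rewrite ltr_pdivrMr //; lra.
have sy : (size y <= M)%N.
  apply: (digits_size Q1 yd).
  have : Q ^+ M * t < Q ^+ M by rewrite gtr_pMr // exprn_gt0.
  by have := QV B; lra.
pose t' := Q ^+ B * (Q ^+ M * t - eval_at Q y - beta).
(* The coefficient of [y] at [i] has weight [Q ^+ i / Q ^+ M], so the digits before the block are
   the coefficients in reverse order. *)
exists (fun l => if (l < M)%N then y`_(M - l.+1) == 1 else e (l - M)%N), t'; split.
- have QB : Q ^+ B * Q ^- B = 1 by rewrite divff // gt_eqF // exprn_gt0.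
  have l1 : Q ^+ B * (Q ^- B / 3) <= t'.
    by rewrite /t' ler_pM2l ?exprn_gt0 //; lra.
  have l2 : t' < Q ^+ B * (Q ^- B * (2 / 3)).
    by rewrite /t' ltr_pM2l ?exprn_gt0 //; lra.
  by move: l1 l2; rewrite !mulrA QB; lra.
- by move=> l lB; rewrite ltnNge leq_addr /= addKn.
rewrite big_split_ord /=.
have -> : \sum_(i < M)
      (if (i < M)%N then y`_(M - i.+1) == 1 else e (i - M)%N)%:R * Q ^- i.+1
    = Q ^- M * eval_at Q y.
  rewrite (eval_atE Q sy) mulr_sumr (reindex_inj rev_ord_inj) /=.
  apply: eq_bigr => i _; have iM := ltn_ord i.
  have -> : (M - (M - i.+1).+1)%N = i by rewrite subnSK // subKn // ltnW.
  rewrite ltn_subrL /= (leq_ltn_trans _ iM) //= subnSK //.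
  have QM : Q ^- M = Q ^- (M - i) * Q ^- i by rewrite -invfM -exprD subnK // ltnW.
  have Qi : Q ^- i * Q ^+ i = 1 by rewrite mulVf // gt_eqF // exprn_gt0.
  rewrite QM; case: (yd i) => [->|[_ ->]]; first by rewrite !mul0r mulr0.
  by rewrite !mul1r -mulrA Qi mulr1.
have -> : \sum_(i < B)
      (if (M + i < M)%N then y`_(M - (M + i).+1) == 1 else e (M + i - M)%N)%:R
        * Q ^- (M + i).+1
    = Q ^- M * beta.
  rewrite mulr_sumr; apply: eq_bigr => i _.
  by rewrite ltnNge leq_addr /= addKn -addnS exprD invfM mulrCA.
have QM : Q ^- M * Q ^+ M = 1 by rewrite mulVf // gt_eqF // exprn_gt0.
have QB : Q ^- B * Q ^+ B = 1 by rewrite mulVf // gt_eqF // exprn_gt0.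
have -> : Q ^- (M + B) * t' =
    Q ^- M * (Q ^- B * Q ^+ B) * (Q ^+ M * t - eval_at Q y - beta).
  by rewrite exprD invfM /t'; ring.
rewrite QB mulr1 !mulrBr mulrA QM mul1r; ring.
Qed.

End Density.

(** * Expansions in a complex base *)

Lemma gt0_complex (R : rcfType) (e : R[i]) : 0 < e -> exists2 r : R, e = r%:C & 0 < r.
Proof. by case: e => a b; rewrite ltcE /= => /andP[/eqP -> a0]; exists a. Qed.

Lemma expansionP (R : realType) (q : R[i]) c z : expansion q c z <->
  forall e : R, 0 < e -> exists N, forall n, (N <= n)%N ->
    normc (z - \sum_(k < n) (c k)%:R * q ^- k.+1) < e.
Proof.
rewrite /expansion; split.
  move=> /cvgrPdist_lt cv e e0.
  have [|N _ NP] := cv e%:C; first by rewrite ltcR.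
  exists N => n /NP; rewrite /= /series /= big_mkord.
  by rewrite normr_normc ltcR.
move=> h; apply/cvgrPdist_lt => _ /gt0_complex[e -> /h[N NP]].
exists N => // n /NP lt; rewrite /= /series /= big_mkord.
by rewrite normr_normc ltcR.
Qed.

Lemma sum_blocks (V : zmodType) m L (F : nat -> V) :
  \sum_(k < m * L) F k = \sum_(l < L) \sum_(i < m) F (m * l + i)%N.
Proof.
elim: L => [|L IH]; first by rewrite muln0 !big_ord0.
by rewrite mulnSr big_split_ord /= IH big_ord_recr.
Qed.

Lemma geometric_sum (R : numFieldType) (x : R) n : 1 < x ->
  \sum_(i < n) x ^- i.+1 = (1 - x ^- n) / (x - 1).
Proof.
move=> x1; have xm : x - 1 != 0 by rewrite subr_eq0 gt_eqF.
elim: n => [|n IH]; first by rewrite big_ord0 expr0 invr1 subrr mul0r.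
have x0 : x != 0 by rewrite gt_eqF // (lt_trans ltr01).
have xn : x ^+ n != 0 by rewrite expf_neq0.
by rewrite big_ord_recr /= IH exprS invfM; field; rewrite xm x0 xn.
Qed.

Lemma geometric_sum_le (R : numFieldType) (x : R) k n : 1 < x ->
  \sum_(i < n) x ^- (k + i).+1 <= x ^- k / (x - 1).
Proof.
move=> x1; have x0 : 0 < x by exact: lt_trans x1.
rewrite (eq_bigr (fun i : 'I_n => x ^- k * x ^- i.+1)) => [|i _].
  rewrite -mulr_sumr geometric_sum // ler_pM2l ?invr_gt0 ?exprn_gt0 //.
  rewrite ler_piMl ?invr_ge0 ?subr_ge0 ?(ltW x1) // lerBlDr lerDl.
  by rewrite invr_ge0 exprn_ge0 // ltW.
by rewrite -invfM -exprD addnS.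
Qed.

(** * Grouping digits by their position modulo [m] *)

Section Grouping.
Variables (R : realType) (m : nat) (q : R[i]) (Q : R).
Hypotheses (m0 : (0 < m)%N) (Q1 : 1 < Q) (Q42 : Q ^+ 4 < 2) (qm : q ^+ m = Q%:C).

Let Q0 : 0 < Q. Proof. exact: lt_trans Q1. Qed.

Let q0 : q != 0.
Proof.
apply: contra_eq_neq qm => ->; rewrite expr0n (gtn_eqF m0) /=.
by rewrite eq_sym fmorph_eq0 gt_eqF.
Qed.

Let normq1 : 1 < normc q.
Proof.
rewrite ltNge; apply/negP => q1.
have : normc q ^+ m <= 1 by rewrite exprn_ile1 // normc_ge0.
by rewrite -normcX qm normc_real gtr0_norm // leNgt Q1.
Qed.

(** For [k = m * l + (m - j.+1)] the weight [q ^- k.+1] equals [q ^+ j * Q ^- l.+1]; hence the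
    reversed residue. *)
Let idx (k : nat) : 'I_m := rev_ord (Ordinal (ltn_pmod k m0)).

Definition comb (t : 'I_m -> R) : R[i] := \sum_(j < m) (t j)%:C * q ^+ j.

Lemma combD t t' : comb t + comb t' = comb (fun j => t j + t' j).
Proof. by rewrite /comb -big_split; apply: eq_bigr => j _; rewrite rmorphD mulrDl. Qed.

Lemma combZ a t : a%:C * comb t = comb (fun j => a * t j).
Proof. by rewrite /comb mulr_sumr; apply: eq_bigr => j _; rewrite rmorphM mulrA. Qed.

Lemma normc_comb_le t (b : R) : (forall j, `|t j| <= b) ->
  normc (comb t) <= b * \sum_(j < m) normc q ^+ j.
Proof.
move=> tb; rewrite /comb mulr_sumr.
elim/big_ind2: _ => [|x x' y y' xx' yy'|j _]; first by rewrite normc0.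
  by rewrite (le_trans (normcD _ _)) // lerD.
by rewrite normcM normc_real normcX ler_wpM2r // exprn_ge0 // normc_ge0.
Qed.

Lemma regroup L (D : 'I_m -> nat -> bool) :
  \sum_(k < m * L) (D (idx k) (k %/ m)%N)%:R * q ^- k.+1 =
  comb (fun j => \sum_(l < L) (D j l)%:R * Q ^- l.+1).
Proof.
rewrite (sum_blocks m L (fun k => (D (idx k) (k %/ m)%N)%:R * q ^- k.+1)).
rewrite exchange_big /= (reindex_inj rev_ord_inj) /comb /=.
apply: eq_bigr => j _; rewrite rmorph_sum mulr_suml; apply: eq_bigr => l _.
have jm := ltn_ord j.
have mj : (m - j.+1 < m)%N by rewrite ltn_subrL m0.
have -> : idx (m * l + (m - j.+1)) = j.
  by apply: val_inj; rewrite /= mulnC modnMDl modn_small // subnSK // subKn // ltnW.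
have -> : ((m * l + (m - j.+1)) %/ m)%N = l.
  by rewrite mulnC divnMDl // divn_small // addn0.
rewrite rmorphM rmorph_nat fmorphV rmorphXn /= -qm -mulrA; congr (_ * _).
apply: (mulfI (x := q ^+ m ^+ l.+1)); first by rewrite !expf_neq0.
rewrite mulVKf ?expf_neq0 // -[RHS]mul1r.
have -> : q ^+ m ^+ l.+1 = q ^+ j * q ^+ (m * l + (m - j.+1)).+1.
  by rewrite -exprM -exprD; congr (_ ^+ _); move: jm; clear; nia.
by rewrite mulfK ?expf_neq0 // mul1r.
Qed.

Lemma digit_sum_sup (c : nat -> bool) :
  let s L := \sum_(l < L) (c l)%:R * Q ^- l.+1 in
  exists2 tau : R, 0 <= (Q - 1) * tau <= 1 &
    forall L, 0 <= tau - s L <= Q ^- L / (Q - 1).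
Proof.
move=> s; have Qm : 0 < Q - 1 by rewrite subr_gt0.
have QV n : 0 < Q ^- n by rewrite invr_gt0 exprn_gt0.
have t0 l : 0 <= (c l)%:R * Q ^- l.+1 by rewrite mulr_ge0 // ltW.
have sD L n : 0 <= s (L + n)%N - s L <= Q ^- L / (Q - 1).
  rewrite /s big_split_ord /= addrAC subrr add0r sumr_ge0 //=.
  apply: le_trans (geometric_sum_le L n Q1); apply: ler_sum => l _.
  by rewrite ler_piMl ?(ltW (QV _)) //; case: (c _).
have s00 : s 0%N = 0 by rewrite /s big_ord0.
pose S := [set s n | n in [set: nat]].
have supS : has_sup S.
  split; first by exists (s 0%N), 0%N.
  exists (Q ^- 0 / (Q - 1)) => _ [n _ <-].
  by have := sD 0%N n; rewrite add0n s00 subr0 => /andP[].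
have bnd L : 0 <= sup S - s L <= Q ^- L / (Q - 1).
  apply/andP; split; first by rewrite subr_ge0; apply: ub_le_sup; [case: supS|exists L].
  rewrite lerBlDr; apply: ge_sup; first by case: supS.
  move=> _ [n _ <-]; case: (leqP L n) => Ln.
    by have := sD L (n - L)%N; rewrite subnKC // lerBlDr => /andP[].
  have := sD n (L - n)%N; rewrite subnKC ?(ltnW Ln) // subr_ge0 => /andP[le _].
  by apply: le_trans le _; rewrite lerDr divr_ge0 ?(ltW (QV _)) // ltW.
exists (sup S) => //; have := bnd 0%N; rewrite s00 subr0 expr0 invr1.
by rewrite ler_pdivlMr // mulrC => /andP[s0 ->]; rewrite mulr_ge0 // ltW.
Qed.

(** Each coordinate collects a real series in base [Q] with sum in [[0, 1/(Q - 1)]]. The limit is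
    identified by comparing partial sums of length [m * L], where the geometric tails are
    explicit. *)
Lemma expandable_comb (c : nat -> bool) x : expansion q c x ->
  exists2 t : 'I_m -> R, (forall j, 0 <= t j <= 1) & (Q - 1)%:C * x = comb t.
Proof.
move=> /expansionP cv.
pose D (j : 'I_m) l := c (m * l + (m - j.+1))%N.
have /choice[tau tauP] (j : 'I_m) : exists tau : R, 0 <= (Q - 1) * tau <= 1 /\
    forall L, 0 <= tau - \sum_(l < L) (D j l)%:R * Q ^- l.+1 <= Q ^- L / (Q - 1).
  by have [tau] := digit_sum_sup (D j); exists tau.
exists (fun j => (Q - 1) * tau j) => [j|]; first by case: (tauP j).
rewrite -combZ; congr (_ * _).
apply/eqP; rewrite -subr_eq0; apply/eqP/eq0_normc/eqP.
rewrite eq_le normc_ge0 andbT leNgt; apply/negP => e0.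
set e := normc _ in e0; have e20 : 0 < e / 2 by rewrite divr_gt0.
have [N NP] := cv _ e20.
pose K := \sum_(j < m) normc q ^+ j.
have K0 : 0 <= K by apply: sumr_ge0 => j _; rewrite exprn_ge0 // normc_ge0.
have [L0 L0P] := exists_exprn_gt Q1 (K / (Q - 1) / (e / 2)).
pose L := maxn N L0.
have QL : Q ^+ L0 <= Q ^+ L by rewrite ler_weXn2l ?(ltW Q1) // leq_maxr.
have NL : (N <= m * L)%N by rewrite (leq_trans (leq_maxl N L0)) // leq_pmull.
have := NP _ NL.
have -> : \sum_(k < m * L) (c k)%:R * q ^- k.+1 =
    \sum_(k < m * L) (D (idx k) (k %/ m)%N)%:R * q ^- k.+1.
  apply: eq_bigr => k _; congr ((c _)%:R * _).
  have km := ltn_pmod k m0.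
  by rewrite /= subnSK // subKn ?(ltnW km) // [(m * (k %/ m))%N]mulnC -divn_eq.
rewrite regroup; set s := fun j => _ => lt.
have := normc_dist (x - comb tau) (x - comb s).
have -> : x - comb tau - (x - comb s) = comb (fun j => (-1) * (tau j - s j)).
  rewrite -combZ.
  rewrite -[X in _ = _ * X](_ : comb tau + comb (fun j => (-1) * s j) = _).
    by rewrite -combZ rmorphN rmorph1; ring.
  by rewrite combD; apply: eq_bigr => j _; rewrite mulN1r.
have le : normc (comb (fun j => (-1) * (tau j - s j))) <= Q ^- L / (Q - 1) * K.
  apply: normc_comb_le => j; case: (tauP j) => _ /(_ L).
  by rewrite mulN1r normrN => /andP[h1 h2]; rewrite ger0_norm.
have : Q ^- L / (Q - 1) * K < e / 2.
  have -> : Q ^- L / (Q - 1) * K = K / (Q - 1) / Q ^+ L by rewrite mulrC mulrCA mulrC.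
  rewrite ltr_pdivrMr ?exprn_gt0 // [e / 2 * _]mulrC -ltr_pdivrMr //.
  exact: lt_le_trans L0P QL.
rewrite -/e; lra.
Qed.

(** Pushed slightly away from the centre [z0], the point stays in the set and so has coordinates in
    [[0, 1]]; pulling it back towards [z0], whose coordinates are [1/2], makes them strictly
    interior. *)
Lemma interior_comb (z : R[i]^o) :
  interior [set ((Q - 1)%:C * x : R[i]^o) | x in expandable q] z ->
  exists2 t : 'I_m -> R, (forall j, 0 < t j < 1) & z = comb t.
Proof.
move=> /nbhs_normP[_ /= /gt0_complex[r -> e0] sub].
pose z0 := comb (fun=> 1 / 2).
pose la := r / 2 / (1 + normc (z - z0)).
have n0 := normc_ge0 (z - z0).
have la0 : 0 < la by rewrite !divr_gt0 //; lra.
have lar : la * normc (z - z0) < r.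
  rewrite /la mulrAC ltr_pdivrMr; last lra.
  by have := mulr_ge0 (ltW e0) n0; lra.
have [|x [c /expandable_comb[t t01 ->]] zE] := sub (z + la%:C * (z - z0)).
  rewrite /ball_ /= opprD addNKr normrN normr_normc ltcR normcM.
  by rewrite normc_real gtr0_norm.
have l1 : 0 < 1 + la by lra.
exists (fun j => (1 + la)^-1 * (t j + la * (1 / 2))) => [j|].
  have := t01 j; rewrite mulrC ltr_pdivlMr // ltr_pdivrMr //; lra.
rewrite -combZ -combD -combZ -/z0 zE.
have -> : z + la%:C * (z - z0) + la%:C * z0 = (1 + la)%:C * z.
  by rewrite rmorphD rmorph1; ring.
by rewrite mulrA -rmorphM mulVf ?gt_eqF // mul1r.
Qed.

Lemma steer_word (t : 'I_m -> R) (b : seq bool) : (forall j, 0 < t j < 1) ->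
  exists (w : seq bool) (t' : 'I_m -> R), [/\ (0 < size w)%N, forall j, 0 < t' j < 1,
    exists n, forall i, (i < size b)%N ->
      (n + i < size w)%N /\ nth false w (n + i) = nth false b i &
    comb t = \sum_(k < size w) (nth false w k)%:R * q ^- k.+1
             + q ^- size w * comb t'].
Proof.
(* The successor keeps the word nonempty even for empty [b]. Coordinate [j] receives the letters of
   [b] at its own positions, padded with [false]. *)
move=> t01; pose B := (size b).+1.
pose e (j : 'I_m) l := nth false b (m * l + (m - j.+1)).
have /choice[M0 M0P] (j : 'I_m) := steer_block Q1 Q42 (e j) B (t01 j).
pose M := \max_(j < m) M0 j.
have /choice[d /choice[t' dP]] (j : 'I_m) := M0P j M (@leq_bigmax _ M0 j).
pose w := mkseq (fun k => d (idx k) (k %/ m)%N) (m * (M + B)).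
have sw : size w = (m * (M + B))%N by rewrite size_mkseq.
exists w, t'; split.
- by rewrite sw muln_gt0 m0 addnS.
- by move=> j; case: (dP j).
- exists (m * M)%N => i ib; have iB : (i %/ m < B)%N.
    by rewrite ltnS (leq_trans (leq_div _ _)) // ltnW.
  have lt : (m * M + i < m * (M + B))%N.
    rewrite mulnDr ltn_add2l (leq_trans ib) // (leq_trans (leqnSn _)) // leq_pmull //.
  rewrite sw; split=> //; rewrite nth_mkseq //.
  have -> : idx (m * M + i) = idx i.
    by apply: val_inj; rewrite /= mulnC modnMDl.
  rewrite mulnC divnMDl //; case: (dP (idx i)) => _ -> // _.
  have im := ltn_pmod i m0.
  by rewrite /e /= subnSK // subKn ?(ltnW im) // mulnC -divn_eq.
rewrite sw exprM qm -rmorphXn -fmorphV combZ.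
have -> : \sum_(k < m * (M + B)) (nth false w k)%:R * q ^- k.+1 =
    \sum_(k < m * (M + B)) (d (idx k) (k %/ m)%N)%:R * q ^- k.+1.
  by apply: eq_bigr => k _; rewrite nth_mkseq.
rewrite regroup combD; apply: eq_bigr => j _.
by case: (dP j) => _ _ {1}->.
Qed.

(** All finite blocks are enumerated by [unpickle] and inserted one after another by [steer_word].
    The remainders have bounded coordinates, so division by growing powers of [q] sends them to
    0. *)
Lemma universal_expansion (t : 'I_m -> R) : (forall j, 0 < t j < 1) ->
  exists c, expansion q c (comb t) /\ universal c.
Proof.
move=> t01.
have /choice[f fP] (x : ('I_m -> R) * seq bool) : exists y : seq bool * ('I_m -> R),
    (forall j, 0 < x.1 j < 1) ->
    [/\ (0 < size y.1)%N, forall j, 0 < y.2 j < 1,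
    exists n, forall i, (i < size x.2)%N ->
      (n + i < size y.1)%N /\ nth false y.1 (n + i) = nth false x.2 i &
    comb x.1 = \sum_(k < size y.1) (nth false y.1 k)%:R * q ^- k.+1
             + q ^- size y.1 * comb y.2].
  case: (pselect (forall j, 0 < x.1 j < 1)) => [h|h]; last by exists ([::], x.1).
  by have [w [t' H]] := steer_word x.2 h; exists (w, t').
pose blk n : seq bool := odflt [::] (unpickle n).
(* The state is the word written so far and the coordinates of the rescaled remainder. *)
pose st := fix st n := if n is k.+1 then
    let y := f ((st k).2, blk k) in ((st k).1 ++ y.1, y.2) else ([::] : seq bool, t).
have stP n : forall j, 0 < (st n).2 j < 1.
  by elim: n => [//|n IH]; case: (fP ((st n).2, blk n) IH).
have szS n : (size (st n).1 < size (st n.+1).1)%N.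
  by rewrite /= size_cat -addn1 leq_add2l; case: (fP ((st n).2, blk n) (stP n)).
have sz n : (n <= size (st n).1)%N by elim: n => // n /leq_ltn_trans; apply.
have pre n d k : (k < size (st n).1)%N ->
    nth false (st (n + d)%N).1 k = nth false (st n).1 k.
  move=> kn; elim: d => [|d IH]; first by rewrite addn0.
  rewrite addnS /= nth_cat ifT ?IH //; apply: leq_trans kn _.
  elim: d {IH} => [|d IH]; first by rewrite addn0.
  by rewrite addnS (leq_trans IH) // ltnW.
(* The word of stage [k.+1] has more than [k] letters, so the default is never read. *)
pose c k := nth false (st k.+1).1 k.
have cE n k : (k < size (st n).1)%N -> c k = nth false (st n).1 k.
  move=> kn; rewrite /c; case: (leqP n k.+1) => nk.
    by rewrite -(subnKC nk) pre.
  by rewrite -(subnKC (ltnW nk)) pre.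
pose K := \sum_(j < m) normc q ^+ j.
have K0 : 0 <= K by apply: sumr_ge0 => j _; rewrite exprn_ge0 // normc_ge0.
have inv n : comb t = \sum_(k < size (st n).1) (c k)%:R * q ^- k.+1
             + q ^- size (st n).1 * comb (st n).2.
  elim: n => [|n IH]; first by rewrite /= big_ord0 add0r expr0 invr1 mul1r.
  have sE : size (st n.+1).1 = (size (st n).1 + size (f ((st n).2, blk n)).1)%N.
    by rewrite /= size_cat.
  rewrite sE big_split_ord /= {1}IH -addrA; congr (_ + _).
  case: (fP ((st n).2, blk n) (stP n)) => _ _ _ -> /=.
  rewrite mulrDr mulr_sumr exprD invfM mulrA; congr (_ + _).
  apply: eq_bigr => k _; rewrite mulrCA -invfM -exprD addnS; congr (_%:R * _).
  rewrite (cE n.+1) ?sE ?ltn_add2l // /= nth_cat ifF; last by rewrite ltnNge leq_addr.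
  by rewrite addKn.
exists c; split.
  apply/expansionP => e e0.
  have nq0 : 0 < normc q by exact: lt_trans normq1.
  pose G := (normc q - 1)^-1 + K.
  have [N NP] := exists_exprn_gt normq1 (G / e).
  exists N => n Nn.
  (* Stage [n] has written [n + r] digits: the error of the partial sum of length [n] is the
     contribution of the last [r] digits plus the remainder, both of order [normc q ^- n]. *)
  have := inv n; rewrite -(subnKC (sz n)) big_split_ord /=.
  set r := (size _ - n)%N => ->.
  have cancel (u v x : R[i]) : u + v + x - u = v + x by ring.
  rewrite cancel.
  have nV k : 0 < normc q ^- k by rewrite invr_gt0 exprn_gt0.
  have l1 : normc (\sum_(i < r) (c (n + i)%N)%:R * q ^- (n + i).+1) <=
      normc q ^- n * (normc q - 1)^-1.
    apply: le_trans (geometric_sum_le n r normq1).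
    elim/big_ind2: _ => [|x x' y y' xx' yy'|i _]; first by rewrite normc0.
      by rewrite (le_trans (normcD _ _)) // lerD.
    rewrite normcM normcV normcX.
    case: (c _); first by rewrite normc1 mul1r.
    by rewrite normc0 mul0r ltW.
  have l2 : normc (q ^- (n + r) * comb (st n).2) <= normc q ^- n * K.
    rewrite normcM normcV normcX.
    apply: ler_pM; rewrite ?normc_ge0 ?(ltW (nV _)) //.
      by rewrite lef_pV2 ?posrE ?exprn_gt0 // ler_weXn2l ?(ltW normq1) // leq_addr.
    rewrite -[K]mul1r; apply: normc_comb_le => j; have /andP[h1 h2] := stP n j.
    by rewrite gtr0_norm // ltW.
  apply: le_lt_trans (normcD _ _) _; apply: le_lt_trans (lerD l1 l2) _.
  rewrite -mulrDr mulrC ltr_pdivrMr ?exprn_gt0 // [e * _]mulrC -ltr_pdivrMr //.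
  by apply: lt_le_trans NP _; rewrite ler_weXn2l // ltW.
move=> b; pose n := pickle b.
have bE : blk n = b by rewrite /blk /n pickleK.
case: (fP ((st n).2, blk n) (stP n)) => _ _ [k kP] _; rewrite bE /= in kP.
exists (size (st n).1 + k)%N => i ib; have [lt <-] := kP i ib.
rewrite (cE n.+1) /= ?size_cat -addnA bE ?ltn_add2l // nth_cat ifF ?addKn //.
by rewrite ltnNge leq_addr.
Qed.

End Grouping.

Theorem theorem5p2 (R : realType) (m : nat) (omega : R[i]) (p : R)
    (hm : (3 <= m)%N) (homega : omega ^+ m = 1)
    (hp1 : 1 < p) (hp2 : p < 2 `^ ((4 * m)%:R^-1))
    (hpisot : ~ second_pisot (p ^+ (2 * m))) :
  let q : R[i] := p%:C * omega in
  forall z : R[i]^o,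
    interior [set ((p ^+ m - 1)%:C * x : R[i]^o) | x in expandable q] z ->
    exists c : nat -> bool, expansion q c z /\ universal c.
Proof.
move=> q z; set Q := p ^+ m.
have m0 : (0 < m)%N by exact: ltn_trans hm.
have p0 : 0 < p by exact: lt_trans hp1.
have Q1 : 1 < Q by rewrite exprn_egt1 // -lt0n.
have Q42 : Q ^+ 4 < 2.
  rewrite -exprM mulnC; set n := (4 * m)%N in hp2 *.
  have n0 : (0 < n)%N by rewrite muln_gt0.
  have -> : 2 = (2 `^ (n%:R^-1)) ^+ n :> R.
    by rewrite -powR_mulrn ?powR_ge0 // -powRrM mulVf ?powRr1 // pnatr_eq0 -lt0n.
  by rewrite ltrXn2r -?lt0n // ?nnegrE ?powR_ge0 // ltW.
have qm : q ^+ m = Q%:C by rewrite exprMn homega mulr1 rmorphXn.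
move=> /(interior_comb m0 Q1 qm)[t t01 ->].
exact: universal_expansion m0 Q1 Q42 qm t t01.
Qed.
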